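(* Let $0<\varepsilon<1/3$. Let $N$ be a nonnegative integer and $\Lambda$ a complex number with $\operatorname{Re}\Lambda\ge N$. Assume that $\psi$ is an infinitely differentiable function on $0<t<1$ such that $\psi(t)=0$ in $0<t<\varepsilon$ and that $\psi^{(k)}$ is integrable on $(0,1)$ for $0\le k\le N$. Set $\phi(t)=(1-t)^{\Lambda}\psi(t)$. Then $\phi(s^2)$ is an infinitely differentiable function in $0<s<1$, and if $\nu$ is a real number with $\nu\ge-N$, we have $$\int_0^1 s^{\nu+1}\phi(s^2)J_\nu(rs)\,ds=o\bigl(r^{-(N+1/2)}\bigr)\qquad\text{as } r\to\infty .$$
   Context: $J_\nu$ denotes the Bessel function of the first kind of order $\nu$, and $r$ is a positive real variable. Complex powers of positive reals are $x^{a}=e^{a\log x}$. Functions are complex-valued. *)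

(* Defs.v *)
From HB Require Import structures.
From mathcomp Require Import all_boot all_order all_algebra.
From mathcomp Require Import complex.
From mathcomp Require Import all_classical all_reals all_analysis.

Set Implicit Arguments.
Unset Strict Implicit.
Unset Printing Implicit Defensive.

Import Order.TTheory GRing.Theory Num.Theory.
Import numFieldNormedType.Exports.

Local Open Scope classical_set_scope.
Local Open Scope ring_scope.
Local Open Scope complex_scope.

(* makes the library's Landau notations available at +oo *)
Canonical pinfty_nbhs_filter_on (K : numFieldType) :=
  @FilterType K (pinfty_nbhs K) _.

Section ComplexValued.
Variable R : realType.
Implicit Types (f : R -> R[i]) (D : set R).

Definition reF f : R -> R := fun x => complex.Re (f x).
Definition imF f : R -> R := fun x => complex.Im (f x).

(* Iterated derivative of a complex-valued function of a real variable. At a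
   point of an open set it depends only on the values of f on that set. *)
Definition cderiv1n (n : nat) f : R -> R[i] :=
  fun x => derive1n n (reF f) x +i* derive1n n (imF f) x.

(* Meant for an open set D. *)
Definition csmooth D f : Prop :=
  forall (n : nat) (x : R), D x ->
    derivable (derive1n n (reF f)) x 1 /\ derivable (derive1n n (imF f)) x 1.

Definition cintegrable D f : Prop :=
  (@lebesgue_measure R).-integrable D (EFin \o reF f) /\
  (@lebesgue_measure R).-integrable D (EFin \o imF f).

Definition cintegral D f : R[i] :=
  Rintegral (@lebesgue_measure R) D (reF f) +i*
  Rintegral (@lebesgue_measure R) D (imF f).

Definition cexp (z : R[i]) : R[i] :=
  let: a +i* b := z in (expR a * cos b) +i* (expR a * sin b).

(* x^a = e^(a log x), for x > 0 *)
Definition cpow (x : R) (a : R[i]) : R[i] := cexp (a * (ln x)%:C).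

End ComplexValued.

Section Bessel.
Variable R : realType.

(* The entire function 1/Gamma on the real line, by Gauss's product formula
     1/Gamma(x) = lim_n x (x + 1) ... (x + n) / (n! n^x);
   it is 0 at the poles 0, -1, -2, ... of Gamma. *)
Definition rgamma (x : R) : R :=
  limn (fun n : nat => (\prod_(k < n.+1) (x + k%:R)) / (n`!%:R * n%:R `^ x)).

(* J_nu(x) = sum_m (-1)^m / (m! Gamma(m + nu + 1)) (x / 2)^(2 m + nu),
   for real nu and x > 0 *)
Definition besselJ (nu x : R) : R :=
  limn (fun n : nat => \sum_(m < n)
    (-1) ^+ m / m`!%:R * rgamma (m%:R + nu + 1) * (x / 2) `^ ((2 * m)%:R + nu)).

End Bessel.

(* Main.v *)
Require Import Defs.
From HB Require Import structures.
From mathcomp Require Import all_boot all_order all_algebra.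
From mathcomp Require Import complex.
From mathcomp Require Import all_classical all_reals all_analysis.
From mathcomp Require Import measurable_realfun ring lra.

Import Order.TTheory GRing.Theory Num.Theory.
Import numFieldNormedType.Exports.

Local Open Scope classical_set_scope.
Local Open Scope ring_scope.
Local Open Scope complex_scope.

(* Since (s^(nu+1) J_(nu+1)(r s))' = r s^(nu+1) J_nu(r s), integrating by parts
   turns the integral with (phi, nu) into -2/r times the one with
   (phi', nu + 1); the boundary terms vanish because phi is 0 near 0 and
   phi^(k)(t) -> 0 as t -> 1 for k < N. After N steps the order is nu + N >= 0 and
   phi^(N) is integrable. Then J_mu(x) = O(x^(-1/2)) makes the part of the integral
   near s = 1 at most a small multiple of r^(-1/2), and on the remaining compact
   interval one more integration by parts gains a further factor 1/r. *)

(** No limit of psi^(k) at 1 is given, only integrability. For k < N the next derivative is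
    integrable too, so psi^(k) is bounded near 1; each derivative takes one power of 1 - t off the
    bound for (1 - t)^Lambda, and Re Lambda >= N leaves at least one power in every boundary term.
    The N-th derivative of phi may have no limit at 1, so the last integration by parts has to stop
    at some b < 1 fixed before r; the piece beyond b is small only through the tail of an L1
    function, whence o without a rate. Decay of J at infinity is needed only for orders at least 0:
    negative orders enter through recurrences, valid for every real order because the functional
    equation of 1/Gamma holds on the whole line. *)

(** * The power series of J, its derivative and its recurrences *)

Section BesselFunction.
Context {R : realType}.
Implicit Types (nu mu x y : R).

(* No convergence of Gauss's product is needed: the products for x and x + 1
   converge together, and the limit of a divergent sequence is 0. *)
Lemma rgammaS x : rgamma x = x * rgamma (x + 1).
Proof.
(* At x = 0 the factor with k = 0 annihilates every product; the argument below divides by x. *)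
have [->|x0] := eqVneq x 0.
  rewrite mul0r /rgamma (_ : (fun _ => _) = cst 0) ?lim_cst//.
  by apply/funext => n /=; rewrite big_ord_recl /= addr0 !mul0r.
pose G x n : R := (\prod_(k < n.+1) (x + k%:R)) / (n`!%:R * n%:R `^ x).
rewrite -[rgamma x]/(limn (G x)) -[rgamma (x + 1)]/(limn (G (x + 1))).
(* Going from x to x + 1 drops the factor x, gains x + n + 1 and multiplies n^x by n: up to x, the
   products differ by [q n], which tends to 1. *)
pose q n : R := (x + n.+1%:R) / n%:R.
have q1 : q n @[n --> \oo] --> (1 : R).
  rewrite -cvg_shiftS /=.
  have -> : (fun n => q n.+1) = (fun n => (x + 1) * n.+1%:R^-1 + 1) :> (nat -> R).
    apply/funext => n; rewrite /q.
    have n0 : n.+1%:R != 0 :> R by rewrite pnatr_eq0.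
    by rewrite -(natr1 n.+1); field; rewrite ?natr1.
  suff : (x + 1) * n.+1%:R^-1 + 1 @[n --> \oo] --> (x + 1) * 0 + 1 by rewrite mulr0 add0r.
  by apply: cvgD; [apply: cvgM; [exact: cvg_cst|exact: cvg_harmonic]|exact: cvg_cst].
have qE n : (0 < n)%N -> G x n * q n = x * G (x + 1) n.
  move=> n0; rewrite /G /q.
  have n0' : n%:R != 0 :> R by rewrite pnatr_eq0 -lt0n.
  have nx : n%:R `^ x != 0 :> R by rewrite powR_eq0 negb_and n0'.
  have nf : n`!%:R != 0 :> R by rewrite pnatr_eq0 -lt0n fact_gt0.
  rewrite powRD ?n0' ?implybT// powRr1//.
  have : (\prod_(k < n.+1) (x + k%:R)) * (x + n.+1%:R)
       = x * \prod_(k < n.+1) (x + 1 + k%:R).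
    rewrite -(big_ord_recr n.+1 (fun k : 'I_n.+2 => x + k%:R)) /=.
    rewrite big_ord_recl /= addr0; congr (_ * _); apply: eq_bigr => i _.
    by rewrite /bump /= -addrA nat1r add1n.
  by rewrite mulf_div => ->; rewrite -!mulrA.
have [cG|dG] := pselect (cvgn (G (x + 1))).
  have GE : x * G (x + 1) n / q n @[n --> \oo] --> x * limn (G (x + 1)) / 1.
    apply: cvgM; first by apply: cvgM; [exact: cvg_cst|exact: cG].
    by apply: cvgV => //; exact: oner_neq0.
  rewrite divr1 in GE; apply: cvg_lim => //; apply: cvg_trans GE.
  apply: near_eq_cvg; near=> n; rewrite -qE; last by near: n; exact: nbhs_infty_gt.
  rewrite mulfK//; near: n.
  have /(@cvgr_neq0 R) := q1; apply; exact: oner_neq0.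
have dGx : ~ cvgn (G x).
  move=> cG; apply: dG; apply/cvg_ex; exists (x^-1 * (limn (G x) * 1)).
  have GE : x^-1 * (G x n * q n) @[n --> \oo] --> x^-1 * (limn (G x) * 1).
    by apply: cvgM; [exact: cvg_cst|apply: cvgM; [exact: cG|exact: q1]].
  apply: cvg_trans GE; apply: near_eq_cvg; near=> n.
  by rewrite qE ?mulKf//; near: n; exact: nbhs_infty_gt.
by rewrite (dvgP dG) (dvgP dGx) mulr0.
Unshelve. all: by end_near. Qed.

(** Once m + x >= 1, the functional equation makes the absolute values nonincreasing in m. The
    choice of [n] guarantees this for m >= n, and the finitely many earlier values are bounded by
    their sum. *)
Lemma rgamma_bounded x : exists M : R, forall m : nat, `|rgamma (m%:R + x)| <= M.
Proof.
pose n := (Num.truncn `|1 - x|).+1.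
pose M := \sum_(k < n.+1) `|rgamma (k%:R + x)|; exists M => m.
have Mle k : (k <= n)%N -> `|rgamma (k%:R + x)| <= M.
  move=> kn; rewrite /M (bigD1 (Ordinal (kn : (k < n.+1)%N))) //=.
  by rewrite lerDl sumr_ge0.
elim: m => [|m IH]; first exact: Mle.
have [mn|nm] := leqP m.+1 n; first exact: Mle.
apply: le_trans IH.
rewrite [in leRHS]rgammaS addrAC natr1 normrM.
have m1 : 1 <= m%:R + x.
  have : (`|1 - x| < n%:R) by rewrite /n; exact: truncnS_gt.
  have : n%:R <= m%:R :> R by rewrite ler_nat.
  have := ler_norm (1 - x); lra.
by rewrite ler_peMl// ger0_norm//; lra.
Qed.

Definition bessel_coef nu (m : nat) : R :=
  (-1) ^+ m / m`!%:R * rgamma (m%:R + nu + 1).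


(** With 1/Gamma bounded along the shifts of nu + 1, the factor 1/m! gives domination by a multiple
    of the exponential series. *)
Lemma bessel_coef_cvg nu x : cvgn (pseries (bessel_coef nu) x).
Proof.
have [M Mle] := rgamma_bounded (nu + 1).
have M0 : 0 <= M by apply: le_trans (Mle 0%N).
apply: normed_cvg.
have := @is_cvg_seriesZ _ _ M (is_cvg_series_exp_coeff `|x|).
apply: series_le_cvg => n /=.
- by [].
- by apply: mulr_ge0 => //; exact: exp_coeff_ge0.
rewrite -[leRHS]/(M * exp_coeff `|x| n).
suff -> : `|bessel_coef nu n * x ^+ n| = `|rgamma (n%:R + (nu + 1))| * exp_coeff `|x| n.
  by apply: ler_wpM2r; [exact: exp_coeff_ge0|exact: Mle].
rewrite /bessel_coef /exp_coeff /= !normrM normfV normrX normrN1 expr1n.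
by rewrite normr_nat normrX addrA; ring.
Qed.

(* J_nu(x) = (x/2)^nu f_nu(x^2/4) with f_nu entire *)
Definition bessel_entire nu y : R := limn (pseries (bessel_coef nu) y).

Lemma pseries_diffs_bessel nu :
  pseries_diffs (bessel_coef nu) = - bessel_coef (nu + 1).
Proof.
apply/funext => m; rewrite /pseries_diffs /bessel_coef fctE.
have m0 : m.+1%:R != 0 :> R by rewrite pnatr_eq0.
have mf : m`!%:R != 0 :> R by rewrite pnatr_eq0 -lt0n fact_gt0.
rewrite factS natrM exprS (_ : m.+1%:R + nu + 1 = m%:R + (nu + 1) + 1); last first.
  by rewrite -natr1; ring.
by field; rewrite mf nat1r.
Qed.

Lemma is_derive_bessel_entire nu y :
  is_derive y 1 (bessel_entire nu) (- bessel_entire (nu + 1) y).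
Proof.
have cN mu z : cvgn (pseries (- bessel_coef mu) z).
  rewrite /pseries (_ : (fun i => _) = - (fun i => bessel_coef mu i * z ^+ i)).
    by rewrite is_cvg_seriesN; exact: bessel_coef_cvg.
  by apply/funext => i; rewrite !fctE mulNr.
apply: is_derive_eq.
  apply: (@pseries_snd_diffs R (bessel_coef nu) (`|y| + 1) y).
  - exact: bessel_coef_cvg.
  - by rewrite pseries_diffs_bessel.
  - rewrite pseries_diffs_bessel pseries_diffsN pseries_diffs_bessel opprK.
    exact: bessel_coef_cvg.
  - by rewrite [ltRHS]ger0_norm ?addr_ge0// ltrDl.
rewrite pseries_diffs_bessel /bessel_entire -lim_seriesN; last exact: bessel_coef_cvg.
congr (limn (series _)); apply/funext => i; exact: mulNr.
Qed.

(** By [rgammaS] the m-th coefficient gains a factor m + nu + 1. The part nu + 1 yields the first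
    series; the part m cancels against m! and shifts the index, so [E] pairs n + 1 terms with n
    terms of the last series. *)
Lemma bessel_entire_rec nu y :
  bessel_entire nu y = (nu + 1) * bessel_entire (nu + 1) y
                       - y * bessel_entire (nu + 1 + 1) y.
Proof.
pose a m := bessel_coef nu m * y ^+ m.
pose b m := bessel_coef (nu + 1) m * y ^+ m.
pose c m := bessel_coef (nu + 1 + 1) m * y ^+ m.
have ca : cvgn (series a) by exact: bessel_coef_cvg.
have cb : cvgn (series b) by exact: bessel_coef_cvg.
have cc : cvgn (series c) by exact: bessel_coef_cvg.
have E n : series a n.+1 = (nu + 1) * series b n.+1 - y * series c n.
  elim: n => [|n IH].
    rewrite /series /= !big_nat1 big_geq// mulr0 subr0 /a /b /bessel_coef !expr0 !mulr1.
    by rewrite fact0 divr1 !mul1r !add0r -rgammaS.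
  rewrite [LHS]seriesSr IH (seriesSr b n.+1) (seriesSr c n).
  suff -> : a n.+1 = (nu + 1) * b n.+1 - y * c n by ring.
  rewrite /a /b /c /bessel_coef [rgamma (_ + nu + 1)]rgammaS.
  have n0 : n.+1%:R != 0 :> R by rewrite pnatr_eq0.
  have mf : n`!%:R != 0 :> R by rewrite pnatr_eq0 -lt0n fact_gt0.
  rewrite (_ : n.+1%:R + nu + 1 + 1 = n%:R + (nu + 1 + 1) + 1); last first.
    by rewrite -natr1; ring.
  rewrite (_ : n.+1%:R + (nu + 1) + 1 = n%:R + (nu + 1 + 1) + 1); last first.
    by rewrite -natr1; ring.
  rewrite factS natrM !exprS -natr1.
  by field; rewrite mf natr1.
have La : series a n.+1 @[n --> \oo] --> bessel_entire nu y.
  by rewrite cvg_shiftS; exact: ca.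
have Lr : series a n.+1 @[n --> \oo] -->
    (nu + 1) * bessel_entire (nu + 1) y - y * bessel_entire (nu + 1 + 1) y.
  under eq_fun do rewrite E.
  apply: cvgB; apply: cvgM; [exact: cvg_cst| |exact: cvg_cst|exact: cc].
  by rewrite cvg_shiftS; exact: cb.
exact: (cvg_unique _ La Lr).
Qed.

Lemma besselJE nu x : 0 < x ->
  besselJ nu x = (x / 2) `^ nu * bessel_entire nu ((x / 2) ^+ 2).
Proof.
move=> x0; have x20 : 0 < x / 2 by rewrite divr_gt0.
have xn0 : x / 2 != 0 by rewrite gt_eqF.
apply: cvg_lim => //.
have h : (x / 2) `^ nu * pseries (bessel_coef nu) ((x / 2) ^+ 2) n @[n --> \oo] -->
    (x / 2) `^ nu * bessel_entire nu ((x / 2) ^+ 2).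
  by apply: cvgM; [exact: cvg_cst|exact: bessel_coef_cvg].
apply: cvg_trans h; apply: near_eq_cvg; near=> n.
rewrite /pseries /series /= big_mkord mulr_sumr; apply: eq_bigr => m _.
rewrite /bessel_coef powRD ?xn0 ?implybT// powR_mulrn ?ltW// exprM; ring.
Unshelve. all: by end_near. Qed.

Lemma is_derive_besselJ nu x : 0 < x ->
  is_derive x 1 (besselJ nu) (nu / x * besselJ nu x - besselJ (nu + 1) x).
Proof.
move=> x0; have x20 : 0 < x / 2 by rewrite divr_gt0.
have xn0 : x / 2 != 0 by rewrite gt_eqF.
apply: (@near_eq_is_derive _ _ _
    (fun x => (x / 2) `^ nu * bessel_entire nu ((x / 2) ^+ 2))).
  by near=> z; rewrite besselJE//; near: z; exact: lt_nbhsr.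
have d1 : is_derive x 1 (fun x : R => x / 2) 2^-1.
  apply: is_derive_eq (is_deriveM (is_derive_id x 1) (is_derive_cst (2^-1 : R) x 1)) _.
  by rewrite scaler0 add0r [LHS]mulr1.
have d2 : is_derive x 1 (fun x : R => (x / 2) ^+ 2) (x / 2).
  by apply: is_derive_eq (is_deriveM d1 d1) _; rewrite -[LHS]/(_ * _ + _ * _); field.
have := is_derive_bessel_entire nu ((x / 2) ^+ 2) => d3.
have := is_derive1_powR nu x20 => d4.
have d5 := @is_derive1_comp _ (fun z : R => z `^ nu) (fun x : R => x / 2) x _ _ d4 d1.
have d6 := @is_derive1_comp _ _ (fun x : R => (x / 2) ^+ 2) x _ _ d3 d2.
apply: is_derive_eq (is_deriveM d5 d6) _.
rewrite /= !besselJE// !powRD ?xn0 ?implybT// powRN !powRr1 ?ltW//.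
rewrite -[X in X + _ = _]/(_ * _) -[X in _ + X = _]/(_ * _).
move: (bessel_entire nu _) (bessel_entire (nu + 1) _) (_ `^ nu) => a b p.
by field; rewrite gt_eqF.
Unshelve. all: by end_near. Qed.

Lemma besselJ_rec nu x : 0 < x ->
  besselJ nu x = 2 * (nu + 1) / x * besselJ (nu + 1) x - besselJ (nu + 1 + 1) x.
Proof.
move=> x0; have x20 : 0 < x / 2 by rewrite divr_gt0.
have xn0 : x / 2 != 0 by rewrite gt_eqF.
rewrite !besselJE// bessel_entire_rec !powRD ?xn0 ?implybT// !powRr1 ?ltW//.
move: (bessel_entire (nu + 1) _) (bessel_entire (nu + 1 + 1) _) (_ `^ nu) => a b p.
by field; rewrite gt_eqF.
Qed.

(** This is (x^(nu+1) J_(nu+1))' = x^(nu+1) J_nu in solved form. Together with [is_derive_besselJ]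
    it makes J_nu and J_(nu+1) a closed first-order linear system. *)
Lemma is_derive_besselJS nu x : 0 < x ->
  is_derive x 1 (besselJ (nu + 1))
    (besselJ nu x - (nu + 1) / x * besselJ (nu + 1) x).
Proof.
move=> x0; apply: is_derive_eq (is_derive_besselJ (nu + 1) x x0) _.
rewrite (besselJ_rec nu x x0).
move: (besselJ (nu + 1) _) (besselJ (nu + 1 + 1) _) => a b.
by field; rewrite gt_eqF.
Qed.

End BesselFunction.

(** * Decay of J at infinity by an energy estimate *)

Section BesselBound.
Context {R : realType}.

(* With p = sqrt x * J_mu, q = sqrt x * J_(mu+1) and k = mu + 1/2 one has
   p' = k p / x - q and q' = p - k q / x, so that F = p^2 + q^2 - (2 k / x) p q
   satisfies F' = (2 k / x^2) p q; for x >= 2 k, F dominates (p^2 + q^2) / 2,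
   hence F exp (2 k / x) is nonincreasing. *)
Lemma besselJ_bound (mu : R) : 0 <= mu ->
  exists X C : R, [/\ 0 < X, 0 <= C & forall x, X <= x ->
    `|besselJ mu x| <= C * x `^ (- (1 / 2)) /\
    `|besselJ (mu + 1) x| <= C * x `^ (- (1 / 2))].
Proof.
move=> mu0; pose k := mu + 1 / 2; pose a := besselJ mu; pose b := besselJ (mu + 1).
(* F exp (2 k / x) without square roots: p^2 = x a^2, q^2 = x b^2 and (2 k / x) p q = 2 k a b. *)
pose G x := (x * (a x ^+ 2 + b x ^+ 2) - 2 * k * (a x * b x)) * expR (2 * k / x).
have k0 : 0 < k by rewrite /k; lra.
have k20 : 0 < 2 * k by rewrite mulr_gt0.
have dG (x : R) : 0 < x -> is_derive x 1 G (expR (2 * k / x) * (2 * k / x) *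
    (a x * b x - (a x ^+ 2 + b x ^+ 2) + 2 * k / x * (a x * b x))).
  move=> x0; have xn0 : x != 0 by rewrite gt_eqF.
  have da := is_derive_besselJ mu x x0; rewrite -/a -/b in da.
  have db := is_derive_besselJS mu x x0; rewrite -/a -/b in db.
  have dab := is_deriveM da db.
  have daa := is_deriveM da da.
  have dbb := is_deriveM db db.
  have dx := is_derive_id x (1 : R).
  have dkV := is_deriveZ (2 * k) (is_deriveV xn0 dx).
  have dE := is_derive1_comp (is_derive_expR _) dkV.
  have dF := is_deriveB (is_deriveM dx (is_deriveD daa dbb)) (is_deriveZ (2 * k) dab).
  apply: is_derive_eq (is_deriveM dF dE) _.
  rewrite /= !fctE; do ![change (?u *: ?v) with (u * v)].
  rewrite -[(_ \*: _) x]/(2 * k * (a x * b x)).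
  by move: (expR _) (a x) (b x) => e u v; rewrite /k; field.
clearbody k.
have Gle (x : R) : 2 * k <= x -> G x <= G (2 * k).
  move=> kx; apply: (@ler0_derive1_nincry _ G (2 * k)) => //.
  - move=> y; rewrite in_itv/= andbT => ky.
    by have [] := dG y (lt_trans k20 ky).
  - move=> y; rewrite in_itv/= andbT => ky.
    have y0 : 0 < y by apply: lt_trans ky; rewrite mulr_gt0.
    rewrite derive1E (@derive_val _ _ _ _ _ _ _ (dG y y0)).
    apply: mulr_ge0_le0; first by rewrite mulr_ge0 ?expR_ge0// divr_ge0// ?mulr_ge0// ltW.
    have q0 : 0 <= 2 * k / y by rewrite divr_ge0// ?mulr_ge0// ltW.
    have q1 : 2 * k / y <= 1 by rewrite ler_pdivrMr// mul1r ltW.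
    move: (2 * k / y) (a y) (b y) q0 q1 => q u v q0 q1.
    (* The right-hand sides of [h1] and [h2] add up to -2 times the bracket in G'; q <= 1 is where x
       >= 2 k enters. *)
    have h1 : 0 <= (1 + q) * (u - v) ^+ 2 by rewrite mulr_ge0 ?sqr_ge0 ?addr_ge0.
    have h2 : 0 <= (1 - q) * (u ^+ 2 + v ^+ 2) by rewrite mulr_ge0 ?subr_ge0 ?addr_ge0 ?sqr_ge0.
    by lra.
  - apply: derivable_within_continuous => y; rewrite in_itv/= andbT => ky.
    by have [] := dG y (lt_le_trans k20 ky).
have G0 : 0 <= G (2 * k).
  rewrite /G mulr_ge0 ?expR_ge0// -mulrBr (pmulr_rge0 _ k20).
  move: (a _) (b _) => u v; have := sqr_ge0 (u - v); have := sqr_ge0 u; have := sqr_ge0 v; lra.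
(* The constant comes from x (a^2 + b^2) / 2 <= F <= G x <= G (2 k), using that the exponential is
   at least 1. *)
exists (2 * k), (Num.sqrt (2 * G (2 * k))); split; first by rewrite mulr_gt0.
  exact: sqrtr_ge0.
move=> x kx.
have x0 : 0 < x by apply: lt_le_trans kx; rewrite mulr_gt0.
have sq : x * (a x ^+ 2 + b x ^+ 2) <= 2 * G (2 * k).
  have e1 : 1 <= expR (2 * k / x).
    by rewrite -expR0 ler_expR divr_ge0 ?mulr_ge0 ?ltW.
  have := Gle x kx; rewrite [in X in X <= _]/G.
  move: (G _) (expR _) e1 (a x) (b x) => g e e1 u v le.
  have h : x * (u ^+ 2 + v ^+ 2) <= 2 * (x * (u ^+ 2 + v ^+ 2) - 2 * k * (u * v)).
    have h1 : 0 <= (x - 2 * k) * (u ^+ 2 + v ^+ 2).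
      by rewrite mulr_ge0 ?subr_ge0// addr_ge0 ?sqr_ge0.
    have h2 : 0 <= 2 * k * (u - v) ^+ 2 by rewrite mulr_ge0 ?sqr_ge0// ltW.
    by lra.
  have h0 : 0 <= x * (u ^+ 2 + v ^+ 2) by rewrite mulr_ge0 ?addr_ge0 ?sqr_ge0// ltW.
  apply: (le_trans h); rewrite ler_pM2l//; apply: le_trans le.
  by apply: ler_peMr => //; lra.
have bnd u : x * u ^+ 2 <= 2 * G (2 * k) ->
    `|u| <= Num.sqrt (2 * G (2 * k)) * x `^ (- (1 / 2)).
  move=> le; rewrite powRN mul1r (powR12_sqrt (ltW x0)) ler_pdivlMr ?sqrtr_gt0//.
  by rewrite -sqrtr_sqr -sqrtrM ?sqr_ge0//; apply: ler_wsqrtr; rewrite mulrC.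
by split; apply: bnd; apply: le_trans sq; rewrite ler_pM2l// ?lerDl ?lerDr sqr_ge0.
Qed.
End BesselBound.

(** * Calculus of smooth functions on an open set *)

Section SmoothOn.
Context {R : realType} (D : set R) (oD : open D).
Implicit Types f g : R -> R.

(** Finite order allows induction: the derivative of a product is a sum of products for which one
    order less is required. *)
Definition smooth_upto (n : nat) f :=
  forall k x, (k < n)%N -> D x -> derivable (derive1n k f) x 1.

Definition smooth_on f := forall n x, D x -> derivable (derive1n n f) x 1.

Lemma smooth_onP f : smooth_on f <-> forall n, smooth_upto n f.
Proof. by split=> [h n k x _|h n x]; [exact: h|exact: (h n.+1)]. Qed.

Lemma smooth_on_derive1 f : smooth_on f -> smooth_on (derive1 f).
Proof. by move=> h n x Dx; rewrite -derive1Sn; exact: h. Qed.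

Lemma smooth_upto_le m n f : (m <= n)%N -> smooth_upto n f -> smooth_upto m f.
Proof. by move=> mn h k x km; apply: h; exact: leq_trans mn. Qed.

Lemma smooth_uptoS n f : smooth_upto n.+1 f <->
  (forall x, D x -> derivable f x 1) /\ smooth_upto n (derive1 f).
Proof.
split=> [h|[h1 h2] [|k] x kn Dx]; last 2 first.
- exact: h1.
- by rewrite derive1Sn; exact: h2.
- split=> [x Dx|k x kn Dx]; first exact: (h 0%N).
  by rewrite -derive1Sn; exact: h.
Qed.

Lemma near_eq_on f g x : {in D, f =1 g} -> D x -> \near x, f x = g x.
Proof.
move=> fg Dx; have := open_nbhs_nbhs (conj oD Dx); apply: filterS => y Dy.
by apply: fg; rewrite inE.
Qed.

Lemma eq_derive1n_on f g n : {in D, f =1 g} -> {in D, derive1n n f =1 derive1n n g}.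
Proof.
elim: n f g => [//|n IH] f g fg x /[!inE] Dx.
rewrite !derive1nS !derive1E; apply: near_eq_derive.
by apply: near_eq_on => //; exact: IH.
Qed.

(** Formulas for derivatives are established only on D, so they must be usable without equality
    elsewhere; D being open, equality on D is equality near each of its points. *)
Lemma eq_smooth_upto n f g : {in D, f =1 g} -> smooth_upto n f -> smooth_upto n g.
Proof.
move=> fg h k x kn Dx; apply: near_eq_derivable (h _ _ kn Dx).
by apply: near_eq_on => //; exact: eq_derive1n_on.
Qed.

Lemma derive1_onE f df : (forall x, D x -> is_derive x 1 f (df x)) ->
  {in D, derive1 f =1 df}.
Proof. by move=> h x /[!inE] Dx; rewrite derive1E; apply/derive_val/h. Qed.

Lemma derive1D_on f g : (forall x, D x -> derivable f x 1) ->
  (forall x, D x -> derivable g x 1) -> {in D, derive1 (f + g) =1 (derive1 f) + (derive1 g)}.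
Proof.
by move=> df dg x /[!inE] Dx; rewrite derive1E deriveD; [rewrite -!derive1E|exact: df|exact: dg].
Qed.

Lemma derive1M_on f g : (forall x, D x -> derivable f x 1) ->
  (forall x, D x -> derivable g x 1) -> {in D, derive1 (f * g) =1 (derive1 f) * g + f * (derive1 g)}.
Proof.
move=> df dg x /[!inE] Dx; rewrite derive1E deriveM; [|exact: df|exact: dg].
by rewrite -!derive1E -[LHS]/(_ * _ + _ * _) addrC [X in X + _ = _]mulrC.
Qed.

Lemma smooth_uptoD n f g : smooth_upto n f -> smooth_upto n g -> smooth_upto n (f + g).
Proof.
elim: n f g => [//|n IH] f g /smooth_uptoS[f0 fS] /smooth_uptoS[g0 gS].
apply/smooth_uptoS; split=> [x Dx|]; first by apply: derivableD; [exact: f0|exact: g0].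
by apply: eq_smooth_upto (IH _ _ fS gS) => x Dx; rewrite derive1D_on.
Qed.

Lemma smooth_uptoM n f g : smooth_upto n f -> smooth_upto n g -> smooth_upto n (f * g).
Proof.
elim: n f g => [//|n IH] f g fn gn.
have [f0 fS] := (smooth_uptoS _ _).1 fn; have [g0 gS] := (smooth_uptoS _ _).1 gn.
apply/smooth_uptoS; split=> [x Dx|]; first by apply: derivableM; [exact: f0|exact: g0].
have fn' := smooth_upto_le _ _ _ (leqnSn n) fn.
have gn' := smooth_upto_le _ _ _ (leqnSn n) gn.
apply: eq_smooth_upto (smooth_uptoD _ _ _ (IH _ _ fS gn') (IH _ _ fn' gS)) => x Dx.
by rewrite derive1M_on.
Qed.

Lemma smooth_onD f g : smooth_on f -> smooth_on g -> smooth_on (f + g).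
Proof.
by move=> /smooth_onP hf /smooth_onP hg; apply/smooth_onP => n; exact: smooth_uptoD.
Qed.

Lemma smooth_onM f g : smooth_on f -> smooth_on g -> smooth_on (f * g).
Proof.
by move=> /smooth_onP hf /smooth_onP hg; apply/smooth_onP => n; exact: smooth_uptoM.
Qed.

Lemma smooth_upto_cst n (c : R) : smooth_upto n (cst c).
Proof.
elim: n c => [//|n IH] c; apply/smooth_uptoS; split=> [x _|]; first exact: derivable_cst.
by apply: eq_smooth_upto (IH 0) => x _; rewrite derive1_cst.
Qed.

Lemma smooth_upto_id n : smooth_upto n id.
Proof.
case: n => [//|n]; apply/smooth_uptoS; split=> [x _|]; first exact: derivable_id.
by apply: eq_smooth_upto (smooth_upto_cst n 1) => x _; rewrite derive1E derive_id.
Qed.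

Lemma smooth_on_continuous f x : smooth_on f -> D x -> {for x, continuous f}.
Proof.
by move=> h Dx; apply/differentiable_continuous/derivable1_diffP; exact: (h 0%N).
Qed.

Lemma smooth_on_is_derive f x : smooth_on f -> D x -> is_derive x 1 f (derive1 f x).
Proof. by move=> h Dx; rewrite derive1E; apply: derivableP; exact: (h 0%N). Qed.

(** A class closed under differentiation on D is smooth there, with no formula for the n-th
    derivative. *)
Lemma smooth_on_stable (C : set (R -> R)) :
  (forall f, C f -> exists2 g, C g & forall x, D x -> is_derive x 1 f (g x)) ->
  C `<=` smooth_on.
Proof.
move=> h f Cf; apply/smooth_onP => n; elim: n f Cf => [//|n IH] f Cf.
have [g Cg dfg] := h f Cf; apply/smooth_uptoS; split=> [x Dx|].
  by have [] := dfg x Dx.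
by apply: eq_smooth_upto (IH g Cg) => x Dx; rewrite (derive1_onE _ _ dfg).
Qed.

Lemma smooth_upto_sqr n f : (forall x, D x -> D (x ^+ 2)) ->
  smooth_upto n f -> smooth_upto n (fun s => f (s ^+ 2)).
Proof.
move=> D2; elim: n f => [//|n IH] f /smooth_uptoS[f0 fS].
have d x : D x -> is_derive x 1 (fun s => f (s ^+ 2)) (derive1 f (x ^+ 2) * (2 * x)).
  move=> Dx; have d1 : is_derive x 1 (fun s : R => s ^+ 2) (2 * x).
    apply: is_derive_eq (is_deriveX 2 (is_derive_id x (1 : R))) _.
    by rewrite -[LHS]/(_ * _) mulr1 expr1.
  rewrite derive1E.
  have d2 := derivableP (f0 _ (D2 _ Dx)).
  exact: (@is_derive1_comp _ f (fun s : R => s ^+ 2) x _ _ d2 d1).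
apply/smooth_uptoS; split=> [x Dx|]; first by have [] := d x Dx.
have s2 : smooth_upto n (cst 2 * id).
  by apply: smooth_uptoM; [exact: smooth_upto_cst|exact: smooth_upto_id].
apply: eq_smooth_upto (smooth_uptoM _ _ _ (IH _ fS) s2) => x Dx.
by rewrite (derive1_onE _ _ d).
Qed.

End SmoothOn.

(** * Integrability and improper integrals on the unit interval *)

Section UnitIntervalIntegrals.
Context {R : realType}.
Notation mu := (@lebesgue_measure R).
Implicit Types f g h F : R -> R.

Definition L1 f := mu.-integrable `]0, 1[ (EFin \o f).

Lemma L1_measurable f : L1 f -> measurable_fun (`]0, 1[ : set R) f.
Proof. by move=> /measurable_int/measurable_EFinP. Qed.

Lemma continuous_on_measurable f :
  (forall x : R, 0 < x < 1 -> {for x, continuous f}) -> measurable_fun (`]0, 1[ : set R) f.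
Proof.
move=> cf; apply: open_continuous_measurable_fun; first exact: interval_open.
move=> x; rewrite inE/= in_itv/= => x01.
exact: cf.
Qed.

Lemma le_L1 f g (C : R) : measurable_fun (`]0, 1[ : set R) f -> L1 g ->
  (forall x : R, 0 < x < 1 -> `|f x| <= C * `|g x|) -> L1 f.
Proof.
move=> mf Lg fg; apply: le_integrable (integrableZl _ C Lg) => //.
  exact/measurable_EFinP.
move=> x /=; rewrite in_itv/= => x01; rewrite lee_fin normrM.
by apply: le_trans (fg x x01) _; rewrite ler_wpM2r// ler_norm.
Qed.

Lemma L1D f g : L1 f -> L1 g -> L1 (f + g).
Proof. by move=> Lf Lg; apply: (integrableD _ Lf Lg). Qed.

Lemma L1Z (c : R) f : L1 f -> L1 (fun x => c * f x).
Proof. by move=> Lf; apply: (integrableZl _ c Lf). Qed.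

Lemma L1M f g (C : R) : measurable_fun (`]0, 1[ : set R) f -> L1 g ->
  (forall x : R, 0 < x < 1 -> `|f x| <= C) -> L1 (f * g).
Proof.
move=> mf Lg fC; apply: (le_L1 _ g C) => //.
  exact: measurable_funM mf (L1_measurable _ Lg).
by move=> x x01; rewrite normrM ler_wpM2r// fC.
Qed.

Lemma eq_L1 f g : (forall x : R, 0 < x < 1 -> f x = g x) -> L1 f -> L1 g.
Proof.
move=> fg; apply: eq_integrable => // x; rewrite inE/= in_itv/= => x01.
by rewrite fg.
Qed.

Lemma FTC2_segment F f (a b : R) : a < b ->
  (forall x : R, a <= x <= b -> is_derive x 1 F (f x)) ->
  (forall x : R, a <= x <= b -> {for x, continuous f}) ->
  mu.-integrable `[a, b] (EFin \o f) /\ \int[mu]_(x in `[a, b]) f x = F b - F a.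
Proof.
move=> ab dF cf.
have cf' : {within `[a, b], continuous f}.
  by apply: continuous_in_subspaceT => x; rewrite inE/= in_itv/=; exact: cf.
split.
  by apply: continuous_compact_integrable => //; exact: segment_compact.
have cF (x : R) : a <= x <= b -> {for x, continuous F}.
  by move=> /dF[dFx _]; apply/differentiable_continuous/derivable1_diffP.
rewrite /Rintegral (@continuous_FTC2 _ f F a b)//.
  split.
  - by move=> x; rewrite in_itv/= => /andP[ax xb]; have [] := dF x; rewrite ?(ltW ax) ?(ltW xb).
  - by apply: cvg_at_right_filter; apply: cF; rewrite lexx ltW.
  - by apply: cvg_at_left_filter; apply: cF; rewrite lexx ltW.
move=> x; rewrite in_itv/= => /andP[ax xb]; rewrite derive1E.
by apply: derive_val; apply: dF; rewrite !ltW.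
Qed.

(** Absolute continuity of the integral, applied on the whole line to f extended by 0. *)
Lemma L1_tail f (e : R) : L1 f -> 0 < e -> exists2 c : R, 0 < c < 1 &
  forall b : R, c <= b < 1 -> \int[mu]_(x in `]b, 1[) `|f x| < e.
Proof.
move=> Lf e0; pose fI := f \_ `]0, 1[.
have LfI : mu.-integrable setT (EFin \o fI).
  by rewrite -restrict_EFin; apply/integrable_restrict => //=; rewrite setTI.
have [d [d0 Hd]] := integral_normr_continuous LfI e0.
(* 1 - d / 2 makes the measure of the tail less than d; 1 / 2 keeps c positive. *)
exists (Num.max (1 / 2) (1 - d / 2)).
  by rewrite lt_max gt_max; apply/andP; split; lra.
move=> b; rewrite ge_max => /andP[/andP[b2 bd] b1].
have -> : \int[mu]_(x in `]b, 1[) `|f x| = \int[mu]_(x in `]b, 1[) `|fI x|.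
  apply: eq_Rintegral => x; rewrite inE/= in_itv/= => /andP[bx x1].
  by rewrite /fI patchE mem_set//= in_itv/= x1 andbT; lra.
apply: Hd; first exact: measurable_itv.
rewrite /= lebesgue_measure_itv/= lte_fin b1 -EFinD lte_fin; lra.
Qed.

Lemma Rintegral_split f (a b : R) : 0 < a -> a < b -> b < 1 -> L1 f ->
  (forall x : R, 0 < x -> x < a -> f x = 0) ->
  \int[mu]_(x in `]0, 1[) f x =
  \int[mu]_(x in `[a, b]) f x + \int[mu]_(x in `]b, 1[) f x.
Proof.
move=> a0 ab b1 Lf f0.
have e1 : `]0%R, 1%R[%classic = `]0%R, b] `|` `]b, 1%R[ :> set R.
  by apply: itv_bndbnd_setU; rewrite bnd_simp//; lra.
have e2 : `]0%R, b]%classic = `]0%R, a[ `|` `[a, b] :> set R.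
  by apply: itv_bndbnd_setU; rewrite bnd_simp//; lra.
have Lb : mu.-integrable `]0%R, b] (EFin \o f).
  by apply: integrableS Lf => //; rewrite e1; exact: subsetUl.
rewrite e1 Rintegral_setU//; [|by rewrite -e1|]; last first.
  apply/disj_set2P; rewrite -subset0 => z/=; rewrite !in_itv/= => -[/andP[_ h1] /andP[h2 _]].
  by move: h1; rewrite leNgt h2.
congr (_ + _); rewrite e2 Rintegral_setU//; [|by rewrite -e2|]; last first.
  apply/disj_set2P; rewrite -subset0 => z/=; rewrite !in_itv/= => -[/andP[_ h1] /andP[h2 _]].
  by move: h1; rewrite ltNge h2.
rewrite [X in X + _](_ : _ = 0) ?add0r//.
rewrite (@eq_Rintegral _ _ _ _ _ (cst 0)) ?Rintegral_cst ?mul0r//.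
by move=> x; rewrite inE/= in_itv/= => /andP[x0 xa]; rewrite f0.
Qed.

(** Regularity is available only inside the open interval, so the fundamental theorem is applied on
    [[a, b]], where it gives F b; as b tends to 1, F b and the L1 tail of h beyond b each stay
    within e / 2. *)
Lemma Rintegral_derive_eq0 F h (a : R) : 0 < a < 1 ->
  (forall x : R, 0 < x < 1 -> is_derive x 1 F (h x)) ->
  (forall x : R, 0 < x < 1 -> {for x, continuous h}) ->
  (forall x : R, 0 < x -> x <= a -> F x = 0) -> (forall x : R, 0 < x -> x < a -> h x = 0) ->
  F x @[x --> 1^'-] --> 0 -> L1 h -> \int[mu]_(x in `]0, 1[) h x = 0.
Proof.
move=> /andP[a0 a1] dF ch F0 h0 F1 Lh; apply/eqP; rewrite -normr_le0.
apply/ler_addgt0Pr => e e0; rewrite add0r.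
have [c /andP[c0 c1] Hc] := L1_tail h (e / 2) Lh ltac:(lra).
near (1 : R)^'- => b.
have b1 : b < 1 by near: b; exact: nbhs_left_lt.
have ab : a < b by near: b; exact: nbhs_left_gt.
have cb : c <= b by near: b; exact: nbhs_left_ge.
have Fb : `|F b| <= e / 2.
  near: b; move/cvgrPdist_le : F1 => /(_ (e / 2)) F1.
  have e20 : 0 < e / 2 by lra.
  by apply: filterS (F1 e20) => x; rewrite sub0r normrN.
have itv (x : R) : a <= x <= b -> 0 < x < 1 by lra.
have [_ E] := FTC2_segment F h a b ab (fun x xab => dF x (itv x xab))
  (fun x xab => ch x (itv x xab)).
rewrite (Rintegral_split h a b)// E (F0 a)// subr0.
apply: (le_trans (ler_normD _ _)).
have ib : mu.-integrable `]b, 1[ (EFin \o h).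
  apply: (integrableS _ _ _ Lh) => //; apply: subset_itvr; rewrite bnd_simp; lra.
have := le_normr_Rintegral _ ib; rewrite -/(measurable _) => /(_ (measurable_itv _)).
have := Hc b; rewrite cb b1 => /(_ isT); lra.
Unshelve. all: by end_near. Qed.

(** Monotone convergence along compact segments exhausting the interval. *)
Lemma L1_of_bounded g (M : \bar R) : (M < +oo)%E ->
  measurable_fun (`]0, 1[ : set R) g ->
  (forall a b : R, 0 < a -> a < b -> b < 1 ->
    (\int[mu]_(x in `[a, b]) `|g x|%:E <= M)%E) -> L1 g.
Proof.
move=> My mg gM; apply/integrableP; split; first exact/measurable_EFinP.
apply: le_lt_trans My.
(* Starting at 1/3 keeps every segment nondegenerate, as [gM] requires. *)
pose A n : set R := `[n.+3%:R^-1, 1 - n.+3%:R^-1]%classic.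
have AI n : A n `<=` `]0, 1[.
  move=> x; rewrite /A /= !in_itv/= => /andP[h1 h2].
  have n0 : 0 < n.+3%:R^-1 :> R by rewrite invr_gt0.
  by move: (_^-1) h1 h2 n0 => q h1 h2 n0; apply/andP; split; lra.
have bA : \bigcup_n A n = `]0, 1[%classic.
  apply/seteqP; split => [x [n _]|x]; first exact: AI.
  rewrite /= in_itv/= => /andP[x0 x1].
  have m0 : 0 < Num.min x (1 - x) by rewrite lt_min x0 subr_gt0.
  have [n _ Hn] := near_infty_natSinv_lt (PosNum m0).
  exists n => //; rewrite /A /= in_itv/=.
  have := Hn n.+2 (leq_trans (leqnSn n) (leqnSn n.+1)); rewrite /= lt_min => /andP[h1 h2].
  by move: (_^-1) h1 h2 => q h1 h2; apply/andP; split; lra.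
rewrite -bA.
have := @ge0_nondecreasing_set_cvg_integral _ (measurableTypeR R) R A (fun x => `|(g x)%:E|)%E mu.
have mA i : measurable_fun (A i) (fun x => `|(g x)%:E|)%E.
  apply: measurableT_comp => //; apply/measurable_EFinP.
  exact: measurable_funS (AI i) mg.
have ndA : nondecreasing_seq A.
  move=> m n mn; apply/subsetPset; apply: subset_itv; rewrite bnd_simp.
    by rewrite lef_pV2 ?posrE// ler_nat.
  by rewrite lerD2l lerN2 lef_pV2 ?posrE// ler_nat.
move=> /(_ ndA (fun i => measurable_itv _) mA (fun i x _ => abse_ge0 _)) H.
rewrite -(cvg_lim _ H)//.
apply: lime_le; first by apply/cvg_ex; exists (\int[mu]_(x in \bigcup_i A i) `|(g x)%:E|)%E.
near=> n; apply: gM.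
- by rewrite invr_gt0.
- have : n.+3%:R^-1 <= 3^-1 :> R by rewrite lef_pV2 ?posrE// ler_nat.
  by move: (n.+3%:R^-1) => q; lra.
- by rewrite ltrBlDr ltrDl invr_gt0.
Unshelve. all: by end_near. Qed.

(** The substitution t = s^2 turns the integral of |s f(s^2)| over [[a, b]] into half that of |f|
    over [[a^2, b^2]]. It is made on compact segments, where f is continuous, and [L1_of_bounded]
    passes to the open interval. *)
Lemma L1_sqr f : (forall x : R, 0 < x < 1 -> {for x, continuous f}) -> L1 f ->
  L1 (fun s => s * f (s ^+ 2)).
Proof.
move=> cf Lf.
have sq (x : R) : 0 < x < 1 -> 0 < x ^+ 2 < 1.
  by move=> /andP[x0 x1]; rewrite exprn_gt0// expr_lt1// ltW.
apply: (L1_of_bounded _ (\int[mu]_(x in `]0%R, 1%R[) `|f x|%:E)%E).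
- by have /integrableP[_] := Lf.
- apply: continuous_on_measurable => x x01; apply: continuousM; first exact: cvg_id.
  apply: (@continuous_comp _ _ _ (fun s : R => s ^+ 2) f); last exact/cf/sq.
  exact: exprn_continuous.
move=> a b a0 ab b1.
pose G x := `|f x| / 2.
pose F (x : R) := x ^+ 2.
have dF (x : R) : is_derive x 1 F (2 * x).
  apply: is_derive_eq (is_deriveX 2 (is_derive_id x (1 : R))) _.
  by rewrite -[LHS]/(_ * _) mulr1 expr1.
have F'E : derive1 F = fun x => 2 * x by apply/funext => x; rewrite derive1E derive_val.
have cF' : continuous (derive1 F).
  by rewrite F'E; exact: mulrl_continuous.
have cF : continuous F by exact: exprn_continuous.
have := @integration_by_substitution_increasing R F G a b (ltW ab).
have -> : (\int[mu]_(x in `[a, b]) ((((G \o F) * derive1 F)%R x)%:E) =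
           \int[mu]_(x in `[a, b]) `|x * f (x ^+ 2)|%:E)%E.
  apply: eq_integral => x; rewrite inE/= in_itv/= => /andP[ax xb].
  rewrite F'E fctE /= /G /F normrM (@ger0_norm _ x) ?(le_trans (ltW a0))//.
  by congr EFin; field.
move=> <-; first last.
- apply: continuous_in_subspaceT => x; rewrite inE/= in_itv/= => /andP[ax xb].
  have x01 : 0 < x < 1.
    have /andP[h1 _] : 0 < a ^+ 2 < 1 by apply: sq; lra.
    have /andP[_ h2] : 0 < b ^+ 2 < 1 by apply: sq; lra.
    by apply/andP; split; [exact: lt_le_trans ax|exact: le_lt_trans h2].
  rewrite /G; apply: (@continuousM _ _ (fun z => `|f z|) (cst 2^-1) x); last exact: cst_continuous.
  apply: continuous_comp; [exact: cf|exact: norm_continuous].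
- split => [x _| |]; first by have [] := dF x.
    by apply: cvg_at_right_filter; exact: cF.
  by apply: cvg_at_left_filter; exact: cF.
- by apply/cvg_ex; eexists; apply: cvg_at_left_filter; exact: cF'.
- by apply/cvg_ex; eexists; apply: cvg_at_right_filter; exact: cF'.
- by move=> x _; exact: cF'.
- move=> x y; rewrite !in_itv/= => /andP[ax _] /andP[ay _] xy.
  by rewrite /F -subr_gt0 subr_sqr mulr_gt0//; lra.
have sub : `[F a, F b] `<=` (`]0, 1[ : set R).
  move=> x; rewrite /= !in_itv/= => /andP[ax xb].
  have /andP[h1 _] : 0 < a ^+ 2 < 1 by apply: sq; lra.
  have /andP[_ h2] : 0 < b ^+ 2 < 1 by apply: sq; lra.
  by apply/andP; split; [exact: lt_le_trans ax|exact: le_lt_trans h2].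
have mf := L1_measurable _ Lf.
apply: (@le_trans _ _ (\int[mu]_(x in `[F a, F b]) `|f x|%:E)%E).
  apply: ge0_le_integral => //.
  - by move=> x _; rewrite lee_fin /G divr_ge0.
  - apply/measurable_EFinP; apply: measurable_funM => //.
    by apply: measurableT_comp => //; exact: measurable_funS sub mf.
  - apply/measurable_EFinP.
    by apply: measurableT_comp => //; exact: measurable_funS sub mf.
  - by move=> x _; rewrite lee_fin /G; have := normr_ge0 (f x); lra.
apply: ge0_subset_integral => //.
by apply/measurable_EFinP; apply: measurableT_comp.
Qed.

End UnitIntervalIntegrals.

(** * Boundary behaviour at 1 and the factor (1 - t)^Lambda *)

Section Admissible.
Context {R : realType}.
Notation mu := (@lebesgue_measure R).
Implicit Types f g w : R -> R.

Definition smooth01 f := smooth_on (`]0, 1[%classic : set R) f.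

(** What N integrations by parts consume: a zero limit at 1 for each derivative of order below N,
    and only integrability at order N. The recursion runs through f' to match the induction on N. *)
Fixpoint admissible (N : nat) f : Prop :=
  L1 f /\ if N is N'.+1 then f x @[x --> 1^'-] --> (0 : R) /\ admissible N' (derive1 f)
          else True.

(** The behaviour at 1 of (1 - t)^Lambda with Re Lambda >= N: each derivative costs one power, and
    order N is still bounded. *)
Definition vanishing_weight (N : nat) w := forall j : nat, (j <= N)%N ->
  exists C : R, forall t : R, 0 < t < 1 -> `|derive1n j w t| <= C * (1 - t) ^+ (N - j).

Let oI : open (`]0, 1[%classic : set R). Proof. exact: interval_open. Qed.

Lemma in01 (x : R) : 0 < x < 1 -> (`]0, 1[%classic : set R) x.
Proof. by rewrite /= in_itv. Qed.

Lemma admissible_L1 N f : admissible N f -> L1 f.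
Proof. by case: N => [|N] []. Qed.

Lemma eq_admissible N f g : {in (`]0, 1[%classic : set R), f =1 g} ->
  admissible N f -> admissible N g.
Proof.
have L f' g' : {in (`]0, 1[%classic : set R), f' =1 g'} -> L1 f' -> L1 g'.
  by move=> fg; apply: eq_L1 => x x01; apply: fg; rewrite inE; exact: in01.
elim: N f g => [|N IH] f g fg [Lf H]; split; try exact: L fg Lf; first by [].
have [f1 Hf'] := H; split.
  apply: cvg_trans f1; apply: near_eq_cvg; near=> x; apply: fg; rewrite inE; apply: in01.
  apply/andP; split; near: x; [exact: nbhs_left_gt|exact: nbhs_left_lt].
apply: IH Hf' => x x01; exact: (@eq_derive1n_on _ _ oI f g 1 fg).
Unshelve. all: by end_near. Qed.

Lemma admissibleD N f g : smooth01 f -> smooth01 g ->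
  admissible N f -> admissible N g -> admissible N (f + g).
Proof.
elim: N f g => [|N IH] f g sf sg [Lf Hf] [Lg Hg]; split; try exact: L1D; first by [].
have [f1 f'] := Hf; have [g1 g'] := Hg; split.
  by rewrite -[X in _ --> X](addr0 0); apply: cvgD.
apply: eq_admissible (IH _ _ (smooth_on_derive1 _ _ sf) (smooth_on_derive1 _ _ sg) f' g').
move=> x x01; symmetry; apply: derive1D_on x01 => y Dy; [exact: (sf 0%N)|exact: (sg 0%N)].
Qed.

Lemma norm_Rintegral_segment f (a b : R) : 0 < a -> a < b -> b < 1 -> L1 f ->
  `|\int[mu]_(x in `[a, b]) f x| <= \int[mu]_(x in `]0, 1[) `|f x|.
Proof.
move=> a0 ab b1 Lf.
have sub : `[a, b] `<=` (`]0, 1[%classic : set R).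
  by apply: subset_itv; rewrite bnd_simp.
have Lab : mu.-integrable `[a, b] (EFin \o f) by apply: integrableS Lf.
apply: le_trans (le_normr_Rintegral _ Lab) _; first exact: measurable_itv.
rewrite /Rintegral fine_le//.
- by apply: integrable_fin_num => //; exact: (integrable_norm Lab).
- by apply: integrable_fin_num => //; exact: (integrable_norm Lf).
apply: ge0_subset_integral => //.
by apply/measurable_EFinP; apply: measurableT_comp => //; exact: L1_measurable.
Qed.

(** Integrating g' from 1/2 controls g up to 1; thus psi^(k) stays bounded near 1 for k < N. *)
Lemma bounded_of_L1_derive g : smooth01 g -> L1 (derive1 g) ->
  exists M : R, forall t : R, 1 / 2 < t < 1 -> `|g t| <= M.
Proof.
move=> sg Lg; exists (`|g (1 / 2)| + \int[mu]_(x in `]0, 1[) `|derive1 g x|).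
move=> t /andP[t2 t1].
have [||_ E] := FTC2_segment g (derive1 g) (1 / 2) t t2.
- move=> x /andP[h1 h2]; apply: smooth_on_is_derive sg _; apply: in01; lra.
- move=> x /andP[h1 h2]; apply: smooth_on_continuous (smooth_on_derive1 _ _ sg) _.
  by apply: in01; lra.
have := norm_Rintegral_segment (derive1 g) (1 / 2) t ltac:(lra) t2 t1 Lg; rewrite E.
have := ler_normD (g (1 / 2)) (g t - g (1 / 2)); rewrite addrC subrK; lra.
Qed.

Lemma vanishing_weight_derive1 N w :
  vanishing_weight N.+1 w -> vanishing_weight N (derive1 w).
Proof. by move=> h j jN; have := h j.+1 jN; rewrite derive1Sn subSS. Qed.

Lemma vanishing_weightW N w : vanishing_weight N.+1 w -> vanishing_weight N w.
Proof.
move=> h j jN; have [C HC] := h j (leqW jN); exists `|C| => t /[dup] t01 /andP[t0 t1].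
apply: le_trans (HC t t01) _.
have u0 : 0 <= (1 - t) ^+ (N - j) by rewrite exprn_ge0// subr_ge0 ltW.
rewrite subSn// exprS.
have p1 : (1 - t) * (1 - t) ^+ (N - j) <= (1 - t) ^+ (N - j) by rewrite ler_piMl//; lra.
have p0 : 0 <= (1 - t) * (1 - t) ^+ (N - j) by rewrite mulr_ge0//; lra.
apply: (@le_trans _ _ (`|C| * ((1 - t) * (1 - t) ^+ (N - j)))).
  by rewrite ler_wpM2r// ler_norm.
by rewrite ler_wpM2l.
Qed.

(** Induction through (w g)' = w' g + w g': w' loses one power by differentiation, and in the other
    term one power of w is given away. The limit at 1 is 0 because g is bounded there and w is at
    most a multiple of 1 - t. *)
Lemma admissibleM N w g : smooth01 w -> smooth01 g -> vanishing_weight N w ->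
  (forall k, (k <= N)%N -> L1 (derive1n k g)) -> admissible N (w * g).
Proof.
have L N' w' g' : smooth01 w' -> vanishing_weight N' w' -> L1 g' -> L1 (w' * g').
  move=> sw vw Lg; have [C HC] := vw 0%N (leq0n N'); apply: (L1M _ _ `|C|) => //.
    apply: continuous_on_measurable => x x01; apply: smooth_on_continuous sw _; exact: in01.
  move=> x /[dup] x01 /andP[x0 x1]; apply: le_trans (HC x x01) _.
  have u0 : 0 <= (1 - x) ^+ (N' - 0) by rewrite exprn_ge0//; lra.
  have u1 : (1 - x) ^+ (N' - 0) <= 1 by rewrite exprn_ile1//; lra.
  apply: le_trans (_ : `|C| * (1 - x) ^+ (N' - 0) <= _).
    by rewrite ler_wpM2r// ler_norm.
  by rewrite ler_piMr.
elim: N w g => [|N IH] w g sw sg vw Lg; split; try exact: L vw (Lg 0%N _); first by [].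
split.
  have [M HM] := bounded_of_L1_derive g sg (Lg 1%N isT).
  have [C HC] := vw 0%N (leq0n _).
  have h : `|C| * `|M| * (1 - x) @[x --> (1 : R)^'-] --> (0 : R).
    apply: cvg_at_left_filter.
    rewrite -[X in _ --> X](_ : `|C| * `|M| * (1 - 1) = 0); last by rewrite subrr mulr0.
    by apply: cvgM; [exact: cvg_cst|apply: cvgB; [exact: cvg_cst|exact: cvg_id]].
  apply/norm_cvg0P; apply: squeeze_cvgr h; last exact: cvg_cst.
  near=> x.
  have x2 : 1 / 2 < x by near: x; apply: nbhs_left_gt; lra.
  have x1 : x < 1 by near: x; exact: nbhs_left_lt.
  have x01 : 0 < x < 1 by lra.
  rewrite normr_ge0 /= normrM mulrAC ler_pM//.
    apply: le_trans (HC x x01) _; rewrite subn0.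
    have u0 : 0 <= (1 - x) ^+ N.+1 by rewrite exprn_ge0//; lra.
    have u1 : (1 - x) ^+ N.+1 <= 1 - x.
      by rewrite exprS ler_piMr ?exprn_ile1//; lra.
    apply: le_trans (_ : `|C| * (1 - x) ^+ N.+1 <= _); first by rewrite ler_wpM2r// ler_norm.
    by rewrite ler_wpM2l.
  by apply: le_trans (HM x _) (ler_norm _); rewrite x2.
have sw' := smooth_on_derive1 _ _ sw; have sg' := smooth_on_derive1 _ _ sg.
have a1 := IH _ _ sw' sg (vanishing_weight_derive1 _ _ vw) (fun k kN => Lg k (leqW kN)).
have a2 : admissible N (w * derive1 g).
  by apply: IH => //; [exact: vanishing_weightW|move=> k kN; rewrite -derive1Sn; exact: Lg].
apply: eq_admissible (admissibleD _ _ _ _ _ a1 a2); [|exact: smooth_onM..].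
by move=> x x01; symmetry; apply: derive1M_on x01 => y Dy; [exact: (sw 0%N)|exact: (sg 0%N)].
Unshelve. all: by end_near. Qed.

(* cospow a b 1 0 and cospow a b 0 1 are the real and imaginary parts of
   (1 - t)^(a + i b). *)
Definition cospow (a b c1 c2 t : R) : R :=
  (1 - t) `^ a * (c1 * cos (b * ln (1 - t)) + c2 * sin (b * ln (1 - t))).

(** Arbitrary coefficients close the family under differentiation. The bracket is Re ((c1 - i c2)
    e^(i b log (1 - t))), and differentiating multiplies c1 - i c2 by -(a + i b) while lowering a by
    1. *)
Lemma is_derive_cospow (a b c1 c2 t : R) : t < 1 ->
  is_derive t 1 (cospow a b c1 c2)
    (cospow (a - 1) b (- a * c1 - b * c2) (- a * c2 + b * c1) t).
Proof.
move=> t1; have u0 : 0 < 1 - t by rewrite subr_gt0.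
have un0 : 1 - t != 0 by rewrite gt_eqF.
have du : is_derive t 1 (fun x : R => 1 - x) (-1).
  by apply: is_derive_eq (is_deriveB (is_derive_cst (1 : R) t 1) (is_derive_id t (1 : R))) _; rewrite sub0r.
have dp := @is_derive1_comp _ (fun z : R => z `^ a) _ t _ _ (is_derive1_powR a u0) du.
have dl := @is_derive1_comp _ _ _ t _ _ (is_derive1_ln u0) du.
have dbl := is_deriveZ b dl.
have dc := is_deriveZ c1 (@is_derive1_comp _ _ _ t _ _ (is_derive_cos _) dbl).
have ds := is_deriveZ c2 (@is_derive1_comp _ _ _ t _ _ (is_derive_sin _) dbl).
apply: is_derive_eq (is_deriveM dp (is_deriveD dc ds)) _.
rewrite /= !fctE /cospow; do ![change (?u *: ?v) with (u * v)].
rewrite -![(_ \*: _) t]/(_ * _) /= powRB ?un0 ?implybT// powRr1 ?(ltW u0)//.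
by move: (cos _) (sin _) (_ `^ a) => c s p; field.
Qed.

Lemma smooth_cospow (a b c1 c2 : R) : smooth01 (cospow a b c1 c2).
Proof.
apply: (@smooth_on_stable _ _ oI [set f | exists a' c1' c2', f = cospow a' b c1' c2']);
  last by exists a, c1, c2.
move=> _ [a' [c1' [c2' ->]]].
exists (cospow (a' - 1) b (- a' * c1' - b * c2') (- a' * c2' + b * c1')).
  by do 3 eexists.
by move=> x; rewrite /= in_itv/= => /andP[_ x1]; exact: is_derive_cospow.
Qed.

Lemma derive1n_cospow (a b c1 c2 : R) (j : nat) : exists c1' c2' : R,
  {in (`]0, 1[%classic : set R), derive1n j (cospow a b c1 c2) =1 cospow (a - j%:R) b c1' c2'}.
Proof.
elim: j => [|j [d1 [d2 IH]]]; first by exists c1, c2 => x _; rewrite subr0.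
exists (- (a - j%:R) * d1 - b * d2), (- (a - j%:R) * d2 + b * d1) => x x01.
rewrite derive1nS; have := @eq_derive1n_on _ _ oI _ _ 1 IH x x01 => /= ->.
rewrite derive1E.
move: x01; rewrite inE/= in_itv/= => /andP[_ x1].
have -> : a - j.+1%:R = a - j%:R - 1 by rewrite -natr1; ring.
by apply: derive_val; exact: is_derive_cospow.
Qed.

(** The imaginary part of the exponent only produces bounded oscillation, and a - j >= N - j with
    base in (0, 1) compares the powers. *)
Lemma vanishing_weight_cospow (N : nat) (a b c1 c2 : R) : N%:R <= a ->
  vanishing_weight N (cospow a b c1 c2).
Proof.
move=> Na j jN; have [d1 [d2 E]] := derive1n_cospow a b c1 c2 j.
exists (`|d1| + `|d2|) => t /[dup] t01 /andP[t0 t1].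
rewrite E ?inE; last exact: in01.
have u0 : 0 < 1 - t by rewrite subr_gt0.
rewrite /cospow normrM mulrC; apply: ler_pM => //.
  apply: le_trans (ler_normD _ _) _; rewrite !normrM; apply: lerD.
    by rewrite ler_piMr// ler_norml cos_geN1 cos_le1.
  by rewrite ler_piMr// ler_norml sin_geN1 sin_le1.
rewrite ger0_norm ?powR_ge0// -powR_mulrn ?(ltW u0)// natrB//.
by apply: ger_powR; [rewrite u0; lra|lra].
Qed.

End Admissible.

(** * The Hankel integrand and one integration by parts *)

Section HankelIntegrand.
Context {R : realType} (eps : R) (eps_gt0 : 0 < eps) (eps_lt1 : eps < 1).
Notation mu := (@lebesgue_measure R).
Implicit Types (f g phi : R -> R) (nu r s : R).

Definition null_near0 f := forall t : R, 0 < t -> t < eps -> f t = 0.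

Definition hankel nu phi r s : R := s `^ (nu + 1) * phi (s ^+ 2) * besselJ nu (r * s).

Lemma null_near0_derive1 f : null_near0 f -> null_near0 (derive1 f).
Proof.
move=> f0 t t0 te.
have oD : open (`]0, eps[%classic : set R) by exact: interval_open.
have E : {in (`]0, eps[%classic : set R), f =1 cst 0}.
  by move=> x; rewrite inE/= in_itv/= => /andP[]; exact: f0.
have := eq_derive1n_on _ oD _ _ 1 E; move=> /= -> //.
  by rewrite derive1_cst.
by rewrite inE/= in_itv/= t0.
Qed.

(** Since eps < 1, the same eps serves for phi(t) and for phi(s^2). *)
Lemma sqr_lt_eps s : 0 < s -> s < eps -> s ^+ 2 < eps.
Proof. move=> s0 se; have : 0 < s * (1 - s) by rewrite mulr_gt0// subr_gt0 (lt_trans se).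
by rewrite expr2; lra. Qed.

Lemma sqr01 s : 0 < s < 1 -> 0 < s ^+ 2 < 1.
Proof. by move=> /andP[s0 s1]; rewrite exprn_gt0// expr_lt1// ltW. Qed.

Lemma hankel_eq0 nu phi r s : null_near0 phi -> 0 < s -> s < eps -> hankel nu phi r s = 0.
Proof.
move=> phi0 s0 se; rewrite /hankel phi0 ?mulr0 ?mul0r ?exprn_gt0//.
exact: sqr_lt_eps.
Qed.

Lemma is_derive_comp_sqr phi s : smooth01 phi -> 0 < s < 1 ->
  is_derive s 1 (fun s => phi (s ^+ 2)) (derive1 phi (s ^+ 2) * (2 * s)).
Proof.
move=> sphi s01.
have d1 : is_derive s 1 (fun s : R => s ^+ 2) (2 * s).
  apply: is_derive_eq (is_deriveX 2 (is_derive_id s (1 : R))) _.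
  by rewrite -[LHS]/(_ * _) mulr1 expr1.
have d2 := smooth_on_is_derive _ _ _ sphi (in01 _ (sqr01 _ s01)).
exact: (@is_derive1_comp _ phi (fun s : R => s ^+ 2) s _ _ d2 d1).
Qed.

Lemma is_derive_besselJ_scale nu r s : 0 < r -> 0 < s ->
  is_derive s 1 (fun s => besselJ (nu + 1) (r * s))
    ((besselJ nu (r * s) - (nu + 1) / (r * s) * besselJ (nu + 1) (r * s)) * r).
Proof.
move=> r0 s0; have rs0 : 0 < r * s by rewrite mulr_gt0.
have d1 : is_derive s 1 (fun s : R => r * s) r.
  by apply: is_derive_eq (is_deriveZ r (is_derive_id s (1 : R))) _; rewrite [LHS]mulr1.
have d2 := is_derive_besselJS nu _ rs0.
exact: (@is_derive1_comp _ _ (fun s : R => r * s) s _ _ d2 d1).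
Qed.

(** The (nu + 1) / s contributions of the power and of J_(nu+1) cancel. The factor 2 s from phi(s^2)
    raises the power to nu + 2, exactly the one that order nu + 1 calls for. *)
Lemma is_derive_hankel nu phi r s : smooth01 phi -> 0 < r -> 0 < s < 1 ->
  is_derive s 1 (fun s => s `^ (nu + 1) * phi (s ^+ 2) * besselJ (nu + 1) (r * s))
    (r * hankel nu phi r s + 2 * hankel (nu + 1) (derive1 phi) r s).
Proof.
move=> sphi r0 /[dup] s01 /andP[s0 s1].
have d1 := is_derive1_powR (nu + 1) s0.
have d2 := is_derive_comp_sqr _ _ sphi s01.
have d3 := is_derive_besselJ_scale nu _ _ r0 s0.
apply: is_derive_eq (is_deriveM (is_deriveM d1 d2) d3) _.
have sn0 : s != 0 by rewrite gt_eqF.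
rewrite /= !fctE /hankel; do ![change (?u *: ?v) with (u * v)].
rewrite addrK !powRD ?sn0 ?implybT// !powRr1 ?(ltW s0)//.
move: (besselJ nu _) (besselJ (nu + 1) _) (derive1 phi _) (phi _) (_ `^ _) => j j' p' p q.
by field; rewrite sn0 gt_eqF.
Qed.

Lemma besselJ_scale_continuous nu r s : 0 < r -> 0 < s ->
  {for s, continuous (fun s => besselJ nu (r * s))}.
Proof.
move=> r0 s0; have [d _] := is_derive_besselJ_scale (nu - 1) r s r0 s0.
by rewrite subrK in d; apply/differentiable_continuous/derivable1_diffP.
Qed.

Lemma powR_continuous_gt0 (a s : R) : 0 < s -> {for s, continuous (fun s : R => s `^ a)}.
Proof.
move=> s0; have [d _] := is_derive1_powR a s0.
exact/differentiable_continuous/derivable1_diffP.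
Qed.

Lemma comp_sqr_continuous phi s : smooth01 phi -> 0 < s < 1 ->
  {for s, continuous (fun s => phi (s ^+ 2))}.
Proof.
move=> sphi s01; have [d _] := is_derive_comp_sqr _ _ sphi s01.
exact/differentiable_continuous/derivable1_diffP.
Qed.

Lemma hankel_continuous nu phi r s : smooth01 phi -> 0 < r -> 0 < s < 1 ->
  {for s, continuous (hankel nu phi r)}.
Proof.
move=> sphi r0 /[dup] s01 /andP[s0 _].
apply: (@continuousM _ _ (fun s => s `^ (nu + 1) * phi (s ^+ 2))
  (fun s => besselJ nu (r * s))); last exact: besselJ_scale_continuous.
apply: (@continuousM _ _ (fun s : R => s `^ (nu + 1)) (fun s => phi (s ^+ 2))).
  exact: powR_continuous_gt0.
exact: comp_sqr_continuous.
Qed.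

Lemma bounded_on_segment f (a b : R) : a <= b ->
  (forall x : R, a <= x <= b -> {for x, continuous f}) ->
  exists C : R, forall x : R, a <= x <= b -> `|f x| <= C.
Proof.
move=> ab cf.
have cf' : {within `[a, b], continuous (fun x => `|f x|)}.
  apply: continuous_in_subspaceT => x; rewrite inE/= in_itv/= => /cf cfx.
  by apply: continuous_comp; [exact: cfx|exact: norm_continuous].
have [c _ Hc] := EVT_max ab cf'; exists `|f c| => x xab.
by apply: Hc; rewrite in_itv.
Qed.

(** On [[eps, 1]] the factor s^nu J_nu(r s) is continuous, hence bounded, whatever the sign of nu;
    the remaining factor s phi(s^2) is integrable by [L1_sqr]. *)
Lemma hankel_L1 nu phi r : smooth01 phi -> null_near0 phi -> L1 phi -> 0 < r ->
  L1 (hankel nu phi r).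
Proof.
move=> sphi phi0 Lphi r0.
have [||C HC] := bounded_on_segment (fun s => s `^ nu * besselJ nu (r * s)) eps 1.
- exact: ltW.
- move=> x /andP[xe _]; have x0 : 0 < x by apply: lt_le_trans xe.
  apply: (@continuousM _ _ (fun s : R => s `^ nu) (fun s => besselJ nu (r * s))).
    exact: powR_continuous_gt0.
  exact: besselJ_scale_continuous.
have Lq : L1 (fun s => s * phi (s ^+ 2)).
  apply: L1_sqr => // x x01; apply: smooth_on_continuous sphi _; exact: in01.
apply: (le_L1 _ _ C) Lq _.
  by apply: continuous_on_measurable => x; exact: hankel_continuous.
move=> x /andP[x0 x1]; have [xe|ex] := ltP x eps.
  rewrite hankel_eq0// normr0 mulr_ge0//.
  by apply: le_trans (HC eps _) => //; rewrite lexx ltW.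
rewrite (_ : hankel nu phi r x = (x `^ nu * besselJ nu (r * x)) * (x * phi (x ^+ 2))).
  by rewrite normrM ler_wpM2r// HC// ex ltW.
have xn0 : x != 0 by rewrite gt_eqF.
by rewrite /hankel powRD ?xn0 ?implybT// powRr1 ?(ltW x0)//; ring.
Qed.

Lemma sqr_cvg_at_left1 : s ^+ 2 @[s --> (1 : R)^'-] --> (1 : R)^'-.
Proof.
move=> A [e /= e0 HA]; have : \forall s \near (1 : R)^'-, A (s ^+ 2); last by [].
near=> s; apply: HA => /=.
  have s1 : s < 1 by near: s; exact: nbhs_left_lt.
  have s2 : 1 - e / 2 < s by near: s; apply: nbhs_left_gt; lra.
  have s3 : 0 < s by near: s; apply: nbhs_left_gt; lra.
  rewrite gtr0_norm; nra.
have s1 : s < 1 by near: s; exact: nbhs_left_lt.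
have s3 : 0 < s by near: s; apply: nbhs_left_gt; lra.
by rewrite expr_lt1// ltW.
Unshelve. all: by end_near. Qed.

Lemma hankel_by_parts nu phi r : smooth01 phi -> null_near0 phi -> L1 phi ->
  L1 (derive1 phi) -> phi x @[x --> 1^'-] --> (0 : R) -> 0 < r ->
  r * \int[mu]_(s in `]0, 1[) hankel nu phi r s =
  - (2 * \int[mu]_(s in `]0, 1[) hankel (nu + 1) (derive1 phi) r s).
Proof.
move=> sphi phi0 Lphi Lphi' phi1 r0; apply/eqP; rewrite -addr_eq0; apply/eqP.
have e0 := eps_gt0; have e1 := eps_lt1.
have sphi' := smooth_on_derive1 _ _ sphi.
have L0 := hankel_L1 nu phi r sphi phi0 Lphi r0.
have L1' := hankel_L1 (nu + 1) _ r sphi' (null_near0_derive1 _ phi0) Lphi' r0.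
rewrite -!RintegralZl// -RintegralD//; last 2 first.
  - exact: L1Z.
  - exact: L1Z.
(* The boundary function must vanish at the left endpoint itself; phi is 0 strictly below eps, so
   eps / 2 is taken. *)
apply: (Rintegral_derive_eq0
  (fun s => s `^ (nu + 1) * phi (s ^+ 2) * besselJ (nu + 1) (r * s)) _ (eps / 2)).
- by apply/andP; split; lra.
- by move=> x x01; exact: is_derive_hankel.
- move=> x x01; apply: (@continuousD _ _ _ (fun s => r * hankel nu phi r s)
    (fun s => 2 * hankel (nu + 1) (derive1 phi) r s)).
    apply: (@continuousM _ _ (cst r) (hankel nu phi r)); first exact: cst_continuous.
    exact: hankel_continuous.
  apply: (@continuousM _ _ (cst 2) (hankel (nu + 1) (derive1 phi) r)).
    exact: cst_continuous.
  exact: hankel_continuous.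
- move=> x x0 xe; rewrite phi0 ?mulr0 ?mul0r ?exprn_gt0//.
  by apply: sqr_lt_eps => //; lra.
- move=> x x0 xe; have xe' : x < eps by lra.
  by rewrite !hankel_eq0 ?mulr0 ?addr0//; exact: null_near0_derive1.
- rewrite -[X in _ --> X](_ : 1 `^ (nu + 1) * 0 * besselJ (nu + 1) (r * 1) = 0); last first.
    by rewrite mulr0 mul0r.
  apply: cvgM; last by apply: cvg_at_left_filter; exact: besselJ_scale_continuous.
  apply: cvgM; first by apply: cvg_at_left_filter; exact: powR_continuous_gt0.
  have H := @cvg_comp _ _ _ _ _ _ _ _ sqr_cvg_at_left1 phi1; exact: H.
- by apply: L1D; exact: L1Z.
Qed.

Lemma norm_Rintegral_le (A : set R) f g (k : R) : measurable A ->
  mu.-integrable A (EFin \o f) -> mu.-integrable A (EFin \o g) ->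
  (forall x, A x -> `|f x| <= k * `|g x|) ->
  `|\int[mu]_(x in A) f x| <= k * \int[mu]_(x in A) `|g x|.
Proof.
move=> mA If Ig fg.
apply: le_trans (le_normr_Rintegral _ If) _; first exact: mA.
have Ig' := integrable_norm Ig.
rewrite -RintegralZl//; apply: le_Rintegral => //; first exact: (integrable_norm If).
by apply: (integrableZl _ k Ig'); exact: mA.
Qed.

End HankelIntegrand.

(** * Asymptotics of the real integrals as r tends to infinity *)

Section HankelAsymptotics.
Context {R : realType} (eps : R) (eps_gt0 : 0 < eps) (eps_lt1 : eps < 1).
Notation mu := (@lebesgue_measure R).
Implicit Types (f g phi : R -> R) (nu r s : R).

(** Keeping s >= eps makes the decay uniform in s: r >= X / eps brings r s past X, and (r s)^(-1/2)
    <= eps^(-1/2) r^(-1/2). *)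
Lemma besselJ_scale_bound nu : 0 <= nu -> exists r0 K : R, [/\ 0 < r0, 0 <= K &
  forall r s : R, r0 <= r -> eps <= s -> s < 1 ->
    `|besselJ nu (r * s)| <= K * r `^ (- (1 / 2)) /\
    `|besselJ (nu + 1) (r * s)| <= K * r `^ (- (1 / 2))].
Proof.
move=> nu0; have [X [C [X0 C0 HX]]] := besselJ_bound nu nu0.
exists (X / eps), (C * eps `^ (- (1 / 2))); split.
- by rewrite divr_gt0.
- by rewrite mulr_ge0// powR_ge0.
move=> r s; rewrite ler_pdivrMr// => Xr es s1.
have r0 : 0 < r by rewrite -(pmulr_lgt0 _ eps_gt0); exact: lt_le_trans Xr.
have s0 : 0 < s by exact: lt_le_trans es.
have Xrs : X <= r * s by apply: le_trans Xr _; rewrite ler_pM2l.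
have le : C * (r * s) `^ (- (1 / 2)) <= C * eps `^ (- (1 / 2)) * r `^ (- (1 / 2)).
  rewrite -mulrA ler_wpM2l// powRM ?(ltW r0) ?(ltW s0)// mulrC.
  rewrite ler_wpM2r ?powR_ge0// !powRN lef_pV2 ?posrE ?powR_gt0//.
  by apply: ge0_ler_powR => //; rewrite ?nnegrE ?(ltW eps_gt0) ?(ltW s0)//; lra.
by have [h1 h2] := HX _ Xrs; split; [apply: le_trans h1 le|apply: le_trans h2 le].
Qed.

Lemma integrable_segment f (a b : R) :
  (forall x : R, a <= x <= b -> {for x, continuous f}) ->
  mu.-integrable `[a, b] (EFin \o f).
Proof.
move=> cf; apply: continuous_compact_integrable; first exact: segment_compact.
by apply: continuous_in_subspaceT => x; rewrite inE/= in_itv/=; exact: cf.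
Qed.

Lemma hankel_asymptotics0 nu phi (d : R) : 0 <= nu -> smooth01 phi ->
  null_near0 eps phi -> L1 phi -> 0 < d ->
  exists2 r0 : R, 0 < r0 & forall r : R, r0 <= r ->
    `|\int[mu]_(s in `]0, 1[) hankel nu phi r s| <= d * r `^ (- (1 / 2)).
Proof.
move=> nu0 sphi phi0 Lphi d0; have e0 := eps_gt0; have e1 := eps_lt1.
have half (p r : R) : 2 * p <= r * d -> p <= r * (d / 2) by lra.
have eh : eps / 2 < eps by lra.
have [r0 [K [r00 K0 HK]]] := besselJ_scale_bound nu nu0.
have sphi' := smooth_on_derive1 _ _ sphi.
pose h s := s `^ (nu + 1) * phi (s ^+ 2).
pose h1 s := s `^ (nu + 1 + 1) * derive1 phi (s ^+ 2).
have h0 s : 0 < s -> s < eps -> h s = 0.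
  by move=> s0 se; rewrite /h phi0 ?mulr0 ?exprn_gt0//; exact: (sqr_lt_eps eps).
have ha0 : h (eps / 2) = 0 by apply: h0 => //; rewrite divr_gt0.
have ch g a (x : R) : smooth01 g -> 0 < x < 1 ->
    {for x, continuous (fun s => s `^ a * g (s ^+ 2))}.
  move=> sg /[dup] x01 /andP[x0 _].
  apply: (@continuousM _ _ (fun s : R => s `^ a) (fun s => g (s ^+ 2))).
    exact: powR_continuous_gt0.
  exact: comp_sqr_continuous.
have Lh : L1 h.
  have Lq : L1 (fun s => s * phi (s ^+ 2)).
    apply: L1_sqr => // x x01; apply: smooth_on_continuous sphi _; exact: in01.
  apply: (le_L1 _ _ 1) Lq _.
    by apply: continuous_on_measurable => x; exact: ch.
  move=> x /andP[x0 x1]; rewrite mul1r /h !normrM ler_wpM2r//.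
  rewrite !ger0_norm ?powR_ge0 ?(ltW x0)// -[leRHS]powRr1 ?(ltW x0)//.
  by apply: ger_powR; [rewrite x0 ltW|lra].
(* The tail will be weighted by K r^(-1/2), and K / (K + 1) <= 1 leaves d / 2; K + 1 allows for K =
   0. *)
have [|c /andP[c0 c1] Hc] := L1_tail h (d / (2 * (K + 1))) Lh.
  by rewrite divr_gt0// mulr_gt0//; lra.
(* Beyond c the tail is small; above eps the Bessel bound applies at b. *)
pose b := Num.max c ((eps + 1) / 2).
have cb : c <= b by rewrite le_max lexx.
have eb : eps < b by rewrite lt_max; apply/orP; right; lra.
have b1 : b < 1 by rewrite gt_max c1/=; lra.
have a0 : 0 < eps / 2 by lra.
have ab : eps / 2 < b by lra.
have itv (x : R) : eps / 2 <= x <= b -> 0 < x < 1 by lra.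
have ih1 : mu.-integrable `[eps / 2, b] (EFin \o h1).
  by apply: integrable_segment => x /itv; exact: ch.
pose M := `|h b| + 2 * \int[mu]_(s in `[eps / 2, b]) `|h1 s|.
(* The second bound gives K M <= r d / 2. M depends on b, hence on d, but not on r. *)
exists (Num.max r0 (2 * (K * M) / d)); first by rewrite lt_max r00.
move=> r; rewrite ge_max => /andP[r0r rM].
have rgt0 : 0 < r by exact: lt_le_trans r0r.
set q := r `^ _; have q0 : 0 <= q by exact: powR_ge0.
have sub x (y z : R) : eps / 2 <= y -> z <= 1 -> y < x < z -> 0 < x < 1 by lra.
have LT := hankel_L1 eps eps_gt0 eps_lt1 nu phi r sphi phi0 Lphi rgt0.
have iT1 : mu.-integrable `[eps / 2, b] (EFin \o hankel (nu + 1) (derive1 phi) r).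
  by apply: integrable_segment => x /itv; exact: hankel_continuous.
have iT : mu.-integrable `[eps / 2, b] (EFin \o hankel nu phi r).
  by apply: integrable_segment => x /itv; exact: hankel_continuous.
(* The Bessel bound is required only for s >= eps, since below eps the left side is 0. *)
have hankel_le (j : R) (nu' : R) g : null_near0 eps g -> 0 <= j ->
    forall s, 0 < s < 1 -> (eps <= s -> `|besselJ nu' (r * s)| <= j) ->
    `|hankel nu' g r s| <= j * `|s `^ (nu' + 1) * g (s ^+ 2)|.
  move=> g0 j0 s /andP[s0 s1] Hj; have [se|es] := ltP s eps.
    by rewrite (hankel_eq0 eps)// normr0 mulr_ge0.
  by rewrite /hankel normrM mulrC ler_wpM2r// Hj.
have Kq0 : 0 <= K * q by rewrite mulr_ge0.
have tail : `|\int[mu]_(s in `]b, 1[) hankel nu phi r s| <= q * (d / 2).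
  have sb : `]b, 1[ `<=` (`]0, 1[%classic : set R).
    by apply: subset_itvr; rewrite bnd_simp; lra.
  have := @norm_Rintegral_le R `]b, 1[ (hankel nu phi r) h (K * q).
  move=> /(_ (measurable_itv _)) H.
  apply: (@le_trans _ _ (K * q * \int[mu]_(s in `]b, 1[) `|h s|)).
    apply: H; [exact: integrableS LT|exact: integrableS Lh|].
    move=> s /=; rewrite in_itv/= => /andP[bs s1].
    apply: hankel_le => //; first by apply/andP; split; lra.
    by move=> es; have [] := HK r s r0r es s1.
  have := Hc b; rewrite cb b1 => /(_ isT) /ltW H'.
  rewrite mulrAC mulrC ler_wpM2l//.
  apply: (@le_trans _ _ (K * (d / (2 * (K + 1))))); first by rewrite ler_wpM2l.
  rewrite mulrA ler_pdivrMr; last by rewrite mulr_gt0//; lra.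
  have : 0 <= K * d by rewrite mulr_ge0// ltW.
  by lra.
have [||_ E] := FTC2_segment
  (fun s => s `^ (nu + 1) * phi (s ^+ 2) * besselJ (nu + 1) (r * s))
  (fun s => r * hankel nu phi r s + 2 * hankel (nu + 1) (derive1 phi) r s)
  (eps / 2) b ab.
- by move=> x /itv x01; exact: is_derive_hankel.
- move=> x /itv x01; apply: (@continuousD _ _ _ (fun s => r * hankel nu phi r s)
    (fun s => 2 * hankel (nu + 1) (derive1 phi) r s)).
    apply: (@continuousM _ _ (cst r) (hankel nu phi r)); first exact: cst_continuous.
    exact: hankel_continuous.
  apply: (@continuousM _ _ (cst 2) (hankel (nu + 1) (derive1 phi) r)).
    exact: cst_continuous.
  exact: hankel_continuous.
rewrite -[X in _ = X]/(h b * besselJ (nu + 1) (r * b)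
  - h (eps / 2) * besselJ (nu + 1) (r * (eps / 2))) in E.
rewrite ha0 mul0r subr0 RintegralD ?RintegralZl// in E; last 2 first.
- by apply: (integrableZl _ r iT); exact: measurable_itv.
- by apply: (integrableZl _ 2 iT1); exact: measurable_itv.
have T1le : `|\int[mu]_(s in `[eps / 2, b]) hankel (nu + 1) (derive1 phi) r s|
    <= K * q * \int[mu]_(s in `[eps / 2, b]) `|h1 s|.
  apply: norm_Rintegral_le => //.
  move=> s /=; rewrite in_itv/= => /andP[as_ sb].
  apply: hankel_le => //; [exact: (null_near0_derive1 eps _ phi0)|by apply: itv; rewrite as_|].
  by move=> es; have [] := HK r s r0r es (le_lt_trans sb b1).
have Fb : `|h b * besselJ (nu + 1) (r * b)| <= K * q * `|h b|.
  rewrite normrM mulrC ler_wpM2r//.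
  by have [] := HK r b r0r (ltW eb) b1.
have segment : `|\int[mu]_(s in `[eps / 2, b]) hankel nu phi r s| <= q * (d / 2).
  rewrite -(ler_pM2l rgt0) -[X in X * `|_|](gtr0_norm rgt0) -normrM.
  have -> : r * \int[mu]_(s in `[eps / 2, b]) hankel nu phi r s =
      h b * besselJ (nu + 1) (r * b) -
      2 * \int[mu]_(s in `[eps / 2, b]) hankel (nu + 1) (derive1 phi) r s.
    by rewrite -[X in _ = X - _]E addrK.
  apply: le_trans (ler_normB _ _) _; rewrite (normrM 2) (@ger0_norm _ 2)//.
  apply: le_trans (lerD Fb (ler_wpM2l _ T1le)) _ => //.
  rewrite (_ : _ + _ = q * (K * M)); last first.
    by rewrite /M; move: `|h b| (Rintegral _ _ _) => u v; ring.
  rewrite [leRHS]mulrCA ler_wpM2l//; apply: half.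
  by move: rM; rewrite ler_pdivrMr.
rewrite (Rintegral_split _ (eps / 2) b)//; last first.
  by move=> x x0 xe; apply: (hankel_eq0 eps) => //; exact: lt_trans eh.
apply: le_trans (ler_normD _ _) _; apply: le_trans (lerD segment tail) _.
by rewrite -mulrDr -splitr mulrC.
Qed.

Lemma hankel_asymptotics (N : nat) nu phi (d : R) : - N%:R <= nu -> smooth01 phi ->
  null_near0 eps phi -> admissible N phi -> 0 < d ->
  exists2 r0 : R, 0 < r0 & forall r : R, r0 <= r ->
    `|\int[mu]_(s in `]0, 1[) hankel nu phi r s| <= d * r `^ (- (N%:R + 1 / 2)).
Proof.
elim: N nu phi d => [|N IH] nu phi d nuN sphi phi0 [Lphi Hphi] d0.
  by rewrite add0r; apply: hankel_asymptotics0 => //; rewrite -oppr0.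
have [phi1 aphi'] := Hphi.
(* Half of d absorbs the factor 2 of the integration by parts. *)
have [| | | | |r0 r00 H] := IH (nu + 1) (derive1 phi) (d / 2).
- by move: nuN; rewrite -natr1; lra.
- exact: smooth_on_derive1.
- exact: (null_near0_derive1 eps _ phi0).
- by [].
- by rewrite divr_gt0.
exists r0 => // r r0r; have rgt0 : 0 < r by exact: lt_le_trans r0r.
rewrite -(ler_pM2l rgt0) -[X in X * `|_|](gtr0_norm rgt0) -normrM.
rewrite (hankel_by_parts eps)//; last exact: admissible_L1 aphi'.
rewrite normrN normrM (@ger0_norm _ 2)//.
have -> : r * (d * r `^ (- (N.+1%:R + 1 / 2))) = d * r `^ (- (N%:R + 1 / 2)).
  have rn0 : r != 0 by rewrite gt_eqF.
  rewrite mulrCA; congr (_ * _).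
  rewrite -[X in X * _](powRr1 (ltW rgt0)) -powRD ?rn0 ?implybT//.
  by congr (_ `^ _); rewrite -natr1; ring.
have := H r r0r; lra.
Qed.

End HankelAsymptotics.

(** * Real and imaginary parts of (1 - t)^Lambda psi(t) *)

Section ComplexAmplitude.
Context {R : realType}.
Implicit Types (p : R -> R) (t : R).

(** Both the real and the imaginary part of (1 - t)^Lambda psi(t) have this form. *)
Lemma smooth_cospow_combination (a b c1 c2 d1 d2 : R) p1 p2 :
  smooth01 p1 -> smooth01 p2 ->
  smooth01 (cospow a b c1 c2 * p1 + cospow a b d1 d2 * p2).
Proof.
move=> s1 s2; have oI : open (`]0, 1[%classic : set R) by exact: interval_open.
by apply: smooth_onD => //; apply: smooth_onM => //; exact: smooth_cospow.
Qed.

Lemma admissible_cospow_combination (N : nat) (a b c1 c2 d1 d2 : R) p1 p2 :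
  N%:R <= a -> smooth01 p1 -> smooth01 p2 ->
  (forall k, (k <= N)%N -> L1 (derive1n k p1)) ->
  (forall k, (k <= N)%N -> L1 (derive1n k p2)) ->
  admissible N (cospow a b c1 c2 * p1 + cospow a b d1 d2 * p2).
Proof.
move=> Na s1 s2 L1p L2p.
have oI : open (`]0, 1[%classic : set R) by exact: interval_open.
have sc := smooth_cospow a b.
apply: admissibleD; try (by apply: smooth_onM => //; exact: sc).
  by apply: admissibleM => //; exact: vanishing_weight_cospow.
by apply: admissibleM => //; exact: vanishing_weight_cospow.
Qed.

Lemma Re_Im_cpowM (L z : R[i]) t : t < 1 ->
  complex.Re (cpow (1 - t) L * z) =
    cospow (complex.Re L) (complex.Im L) 1 0 t * complex.Re z +
    cospow (complex.Re L) (complex.Im L) 0 (-1) t * complex.Im z /\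
  complex.Im (cpow (1 - t) L * z) =
    cospow (complex.Re L) (complex.Im L) 0 1 t * complex.Re z +
    cospow (complex.Re L) (complex.Im L) 1 0 t * complex.Im z.
Proof.
case: L => a b; case: z => x y t1; have u0 : 1 - t != 0 by rewrite gt_eqF// subr_gt0.
rewrite /cpow /cospow /powR (negbTE u0) /=.
rewrite !mulr0 subr0 add0r [in X in cos X]mulrC.
by split; ring.
Qed.

Lemma normc_le (x y e : R) : 0 <= e -> `|x| <= e / 2 -> `|y| <= e / 2 ->
  `|x +i* y| <= e%:C.
Proof.
move=> e0 xe ye; rewrite normc_def /= lecR -[leRHS]ger0_norm// -sqrtr_sqr.
apply: ler_wsqrtr; rewrite -[x ^+ 2]real_normK ?num_real// -[y ^+ 2]real_normK ?num_real//.
have := normr_ge0 x; have := normr_ge0 y; move: (`|x|) (`|y|) xe ye => u v; nra.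
Qed.

End ComplexAmplitude.

Theorem proposition4p3 (R : realType) (eps : R) (N : nat) (Lambda : R[i])
    (psi : R -> R[i])
    (eps_gt0 : 0 < eps) (eps_lt : eps < 1 / 3)
    (Lambda_ge : N%:R <= complex.Re Lambda)
    (psi_smooth : csmooth `]0, 1[ psi)
    (psi_eq0 : forall t : R, 0 < t -> t < eps -> psi t = 0)
    (psi_int : forall k : nat, (k <= N)%N -> cintegrable `]0, 1[ (cderiv1n k psi)) :
  let phi := fun t : R => cpow (1 - t) Lambda * psi t in
  csmooth `]0, 1[ (fun s : R => phi (s ^+ 2)) /\
  forall nu : R, - N%:R <= nu ->
    let integrand := fun r s : R =>
      (s `^ (nu + 1))%:C * phi (s ^+ 2) * (besselJ nu (r * s))%:C in
    (forall r : R, 0 < r -> cintegrable `]0, 1[ (integrand r)) /\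
    (fun r : R => cintegral `]0, 1[ (integrand r) : R[i]^o)
      =o_ (pinfty_nbhs R) (fun r : R => (r `^ (- (N%:R + 1 / 2)))%:C : R[i]^o).
Proof.
move=> phi.
have eps_lt1 : eps < 1 by lra.
have oI : open (`]0, 1[%classic : set R) by exact: interval_open.
pose W c1 c2 := cospow (complex.Re Lambda) (complex.Im Lambda) c1 c2.
pose phi1 : R -> R := W 1 0 * reF psi + W 0 (-1) * imF psi.
pose phi2 : R -> R := W 0 1 * reF psi + W 1 0 * imF psi.
have s1 : smooth01 (reF psi) by move=> n x x01; have [] := psi_smooth n x x01.
have s2 : smooth01 (imF psi) by move=> n x x01; have [] := psi_smooth n x x01.
have L1p k : (k <= N)%N -> L1 (derive1n k (reF psi)) by move=> /psi_int[].
have L2p k : (k <= N)%N -> L1 (derive1n k (imF psi)) by move=> /psi_int[].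
have sphi1 : smooth01 phi1 by exact: smooth_cospow_combination.
have sphi2 : smooth01 phi2 by exact: smooth_cospow_combination.
have aphi1 : admissible N phi1 by exact: admissible_cospow_combination.
have aphi2 : admissible N phi2 by exact: admissible_cospow_combination.
have z1 : null_near0 eps phi1.
  by move=> t t0 te; rewrite /phi1 !fctE /reF /imF psi_eq0//= !mulr0 addr0.
have z2 : null_near0 eps phi2.
  by move=> t t0 te; rewrite /phi2 !fctE /reF /imF psi_eq0//= !mulr0 addr0.
have phiE t : t < 1 -> complex.Re (phi t) = phi1 t /\ complex.Im (phi t) = phi2 t.
  by move=> t1; rewrite /phi; have [-> ->] := Re_Im_cpowM Lambda (psi t) t t1.
have sq01 (s : R) : 0 < s < 1 -> s ^+ 2 < 1 by move=> /sqr01 /andP[].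
have sqI (s : R) : (`]0, 1[%classic : set R) s -> (`]0, 1[%classic : set R) (s ^+ 2).
  by rewrite /= !in_itv/= => /sqr01.
split.
  move=> n x x01; split.
    (* Order [n.+1] is what covers derivability of the n-th derivative. *)
    have h : smooth_upto (`]0, 1[%classic : set R) n.+1 (fun s => phi1 (s ^+ 2)).
      by apply: smooth_upto_sqr => // k y _; exact: sphi1.
    apply: (eq_smooth_upto _ oI _ _ _ _ h n x _ x01) => // s.
    by rewrite inE/= in_itv/= => s01; rewrite /reF; have [] := phiE _ (sq01 _ s01).
  have h : smooth_upto (`]0, 1[%classic : set R) n.+1 (fun s => phi2 (s ^+ 2)).
    by apply: smooth_upto_sqr => // k y _; exact: sphi2.
  apply: (eq_smooth_upto _ oI _ _ _ _ h n x _ x01) => // s.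
  by rewrite inE/= in_itv/= => s01; rewrite /imF; have [] := phiE _ (sq01 _ s01).
move=> nu nuN integrand.
have intE (r s : R) : 0 < s < 1 ->
    reF (integrand r) s = hankel nu phi1 r s /\ imF (integrand r) s = hankel nu phi2 r s.
  move=> s01; have [] := phiE _ (sq01 s s01); rewrite /reF /imF /integrand /hankel.
  move: (phi _) => [x y] /= <- <-.
  by split; ring.
split=> [r r0|].
  split.
    apply: eq_L1 (hankel_L1 eps eps_gt0 eps_lt1 nu phi1 r _ _ _ _) => //.
      by move=> s s01; have [] := intE r s s01.
    exact: admissible_L1 aphi1.
  apply: eq_L1 (hankel_L1 eps eps_gt0 eps_lt1 nu phi2 r _ _ _ _) => //.
    by move=> s s01; have [] := intE r s s01.
  exact: admissible_L1 aphi2.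
apply/eqoP => e e0.
(* The tolerance is a positive element of [R[i]], which forces its imaginary part to vanish. *)
have [e' e'0 ->] : exists2 e' : R, 0 < e' & e = e'%:C.
  case: e e0 => x y; rewrite ltcE /= => /andP[/eqP -> x0]; exists x; [exact: x0|exact: erefl].
(* Each of the two parts gets half of the tolerance, as [normc_le] expects. *)
have e20 : 0 < e' / 2 by rewrite divr_gt0.
have [r1 r10 H1] := hankel_asymptotics eps eps_gt0 eps_lt1 N nu phi1 _ nuN sphi1 z1 aphi1 e20.
have [r2 r20 H2] := hankel_asymptotics eps eps_gt0 eps_lt1 N nu phi2 _ nuN sphi2 z2 aphi2 e20.
near=> r.
have r1r : r1 <= r by near: r; apply: nbhs_pinfty_ge; exact: num_real.
have r2r : r2 <= r by near: r; apply: nbhs_pinfty_ge; exact: num_real.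
have -> : cintegral `]0, 1[ (integrand r) =
    (\int[lebesgue_measure]_(s in `]0, 1[) hankel nu phi1 r s) +i*
    (\int[lebesgue_measure]_(s in `]0, 1[) hankel nu phi2 r s).
  by congr (_ +i* _); apply: eq_Rintegral => s; rewrite inE/= in_itv/= => s01;
    have [] := intE r s s01.
set q := r `^ _; have q0 : 0 <= q by exact: powR_ge0.
have -> : `|q%:C : R[i]^o| = q%:C by rewrite ger0_norm// lecR.
rewrite -rmorphM; apply: normc_le.
- by rewrite mulr_ge0// ltW.
- by rewrite mulrAC; exact: H1.
- by rewrite mulrAC; exact: H2.
Unshelve. all: by end_near. Qed.
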